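(* Let $M$ be any separable tracial von Neumann algebra containing $L(\mathbb{Z})$. Then the space $\mathrm{SubAlg}(M)$ of von Neumann subalgebras of $M$, equipped with the Effros-Maréchal topology, is not compact.
   Context: A separable tracial von Neumann algebra is a von Neumann algebra with separable predual equipped with a faithful normal tracial state. $L(\mathbb{Z})$ is the group von Neumann algebra of $\mathbb{Z}$; containment means as a von Neumann subalgebra. Von Neumann subalgebras are taken with the same unit. Effros-Maréchal (EM) topology: for a von Neumann algebra $\mathcal{N}$ with separable predual, let $\mathrm{SubAlg}(\mathcal{N})$ be the set of von Neumann subalgebras of $\mathcal{N}$. For a sequence $\mathcal{M}_n\in \mathrm{SubAlg}(\mathcal{N})$, let $\liminf_n \mathcal{M}_n$ be the set of $x\in\mathcal{N}$ for which there is a bounded sequence $x_n\in\mathcal{M}_n$ with $x_n\to x$ in the strong-$*$ operator topology, and let $\limsup_n\mathcal{M}_n$ be the von Neumann algebra generated by the set of $x\in\mathcal{N}$ for which there is a bounded sequence $x_n\in\mathcal{M}_n$ with $x_n\to x$ in the weak operator topology. The EM-topology is the (Polish) topology on $\mathrm{SubAlg}(\mathcal{N})$ in which $\mathcal{M}_n\to\mathcal{M}$ if and only if $\liminf_n\mathcal{M}_n=\limsup_n\mathcal{M}_n=\mathcal{M}$.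
   Formalization: The limsup is generated by weak limits along subsequences (weak limit points) of bounded sequences, the standard definition; with limits of full sequences, as worded, A, C1, A, C1, … would converge to C1 and its subsequence A, A, … to A, so no such Polish topology would exist. *)

(* Defs.v *)
From HB Require Import structures.
From mathcomp Require Import all_boot all_order all_algebra.
From mathcomp Require Import sesquilinear complex.
From mathcomp Require Import all_classical all_reals all_analysis.

Set Implicit Arguments.
Unset Strict Implicit.
Unset Printing Implicit Defensive.

Import Order.TTheory GRing.Theory Num.Theory.
Import numFieldNormedType.Exports.

Local Open Scope classical_set_scope.
Local Open Scope ring_scope.
Local Open Scope complex_scope.

(* The inner product is linear in the first argument. *)
Record hilbertType (R : realType) := Hilbert {
  hilbert_sort :> completeNormedModType R[i];
  inner : {dot hilbert_sort for Num.conj};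
  inner_norm : forall x, inner x x = `|x| ^+ 2 }.

Arguments inner {R h}.

Section Operators.
Context {R : realType} {H : hilbertType R}.
Implicit Types (T S : H -> H) (M : set (H -> H)).

Definition bounded_op T := linear T /\ continuous T.

(* A relation, since the library has no Riesz representation theorem; every
   bounded operator has exactly one adjoint. *)
Definition adjoint T S := forall x y, inner (T x) y = inner x (S y).

Definition commutant (A : set (H -> H)) : set (H -> H) :=
  [set T | bounded_op T /\ forall S, A S -> T \o S = S \o T].

Definition von_neumann M :=
  (forall T, M T -> exists2 S, M S & adjoint T S) /\
  commutant (commutant M) = M.

Definition generated_vN (A : set (H -> H)) : set (H -> H) := smallest von_neumann A.

Definition square_summable (xi : nat -> H) :=
  exists C : R, forall n, \sum_(k < n) `|xi k| ^+ 2 <= C%:C.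

(* The predual of M consists of the restrictions to M of the functionals
   T |-> \sum_k <T xi_k, eta_k>, i.e. of the ultraweakly continuous ones. *)
Definition normal_functional M (f : (H -> H) -> R[i]) :=
  exists xi eta : nat -> H,
    [/\ square_summable xi, square_summable eta &
        forall T, M T ->
          series (fun k => inner (T (xi k)) (eta k) : R[i]^o) @ \oo
            --> (f T : R[i]^o)].

(* Norm-separability: the predual norm is the supremum over the unit ball. *)
Definition separable_predual M :=
  exists f : nat -> (H -> H) -> R[i],
    (forall n, normal_functional M (f n)) /\
    forall g, normal_functional M g -> forall e : R, 0 < e ->
      exists n, forall T, M T -> (forall x, `|T x| <= `|x|) ->
        `|g T - f n T| <= e%:C.

(* The values of tau outside M are irrelevant. *)
Record faithful_normal_tracial_state M (tau : (H -> H) -> R[i]) : Prop := {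
  trace_linear : forall (a : R[i]) S T, M S -> M T ->
    tau ((a \*: S) \+ T) = a * tau S + tau T;
  trace_ge0 : forall T S, M T -> adjoint T S -> 0 <= tau (S \o T);
  trace1 : tau idfun = 1;
  trace_faithful : forall T S, M T -> adjoint T S ->
    tau (S \o T) = 0 -> forall x, T x = 0;
  trace_normal : normal_functional M tau;
  traceC : forall S T, M S -> M T -> tau (S \o T) = tau (T \o S) }.

Record orthonormal_basis (I : eqType) (delta : I -> H) : Prop := {
  basis_orthonormal : forall i j, inner (delta i) (delta j) = (i == j)%:R;
  basis_total : forall x, (forall i, inner x (delta i) = 0) -> x = 0 }.

(* When delta is an orthonormal basis indexed by the additive group G, H is
   l^2(G) and delta g is the indicator function of g; the generators are the
   operators of the left regular representation. *)
Definition group_vN (G : zmodType) (delta : G -> H) : set (H -> H) :=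
  generated_vN [set T | bounded_op T /\
                        exists g, forall h, T (delta h) = delta (g + h)].

Definition uniformly_bounded (u : nat -> H -> H) :=
  exists C : R, forall n x, `|u n x| <= C%:C * `|x|.

Definition strong_star_cvg (u : nat -> H -> H) T :=
  exists (v : nat -> H -> H) S,
    [/\ forall n, adjoint (u n) (v n), adjoint T S,
        forall x, u n x @[n --> \oo] --> T x &
        forall x, v n x @[n --> \oo] --> S x].

Definition weak_cvg (u : nat -> H -> H) T :=
  forall x y, (inner (u n x) y : R[i]^o) @[n --> \oo]
    --> (inner (T x) y : R[i]^o).

Definition liminf_vN M (N : nat -> set (H -> H)) : set (H -> H) :=
  [set T | M T /\ exists u,
    [/\ forall n, N n (u n), uniformly_bounded u & strong_star_cvg u T]].

(* Limit points of bounded sequences, not just limits: with limits of full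
   sequences the sequence A, B, A, B, ... would converge to A :&: B. *)
Definition limsup_vN M (N : nat -> set (H -> H)) : set (H -> H) :=
  generated_vN [set T | M T /\ exists (u : nat -> H -> H) (s : nat -> nat),
    [/\ forall n, N n (u n), uniformly_bounded u,
        {homo s : m n / (m < n)%N} & weak_cvg (u \o s) T]].

Record SubAlg M := {
  subalg_set :> set (H -> H);
  subalg_vN : von_neumann subalg_set;
  subalg_sub : subalg_set `<=` M }.

Definition EM_cvg M (N : nat -> SubAlg M) (A : SubAlg M) :=
  liminf_vN M N = A /\ limsup_vN M N = A.

(* The only topology that can be metrizable with EM_cvg as convergence of
   sequences, by EM_open_unique below. *)
Definition EM_open M : set_system (SubAlg M) :=
  [set U | forall (N : nat -> SubAlg M) A, EM_cvg N A -> U A -> \forall n \near \oo, U (N n)].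

Lemma EM_openT M : EM_open [set: SubAlg M].
Proof. by move=> N A _ _; exact: nearW. Qed.

Lemma EM_openI M : setI_closed (@EM_open M).
Proof.
by move=> U V oU oV N A NA [UA VA]; apply: filterI; [exact: oU NA UA|exact: oV NA VA].
Qed.

Lemma EM_open_bigcup M (I : Type) (f : I -> set (SubAlg M)) :
  (forall i, EM_open (f i)) -> EM_open (\bigcup_i f i).
Proof.
move=> of_ N A NA [i _ fiA]; apply: filterS (of_ i N A NA fiA) => n fin.
by exists i.
Qed.

HB.instance Definition _ M := gen_eqMixin (SubAlg M).
HB.instance Definition _ M := gen_choiceMixin (SubAlg M).
HB.instance Definition _ M :=
  isOpenTopological.Build (SubAlg M) (@EM_openT M) (@EM_openI M)
    (@EM_open_bigcup M).

Lemma SubAlg_openE M : @open (SubAlg M) = @EM_open M.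
Proof. by []. Qed.

Lemma EM_open_unique M (X : pseudoMetricType R) (f : X -> SubAlg M) :
  bijective f ->
  (forall (u : nat -> X) x, u @ \oo --> x <-> EM_cvg (f \o u) (f x)) ->
  forall U : set (SubAlg M), open U <-> open (f @^-1` U).
Proof.
move=> [g fK gK] fcvg U; rewrite SubAlg_openE; split => [oU|oU N A NA UA].
- rewrite openE => x Ux; apply: contrapT => nU.
  have H0 n : exists y, ball x (n.+1%:R^-1 : R) y /\ ~ U (f y).
    apply: contrapT => /forallNP nex; apply: nU; rewrite /interior.
    apply/nbhs_ballP; exists n.+1%:R^-1; first by rewrite /= invr_gt0 ltr0n.
    by move=> y xy; apply: contrapT => nUy; apply: (nex y).
  have [u Pu] := choice H0.
  have ux : u @ \oo --> x.
    apply/cvg_ballP => e e0; near=> n.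
    apply: (@le_ball _ _ _ n.+1%:R^-1); last exact: (Pu n).1.
    by apply: ltW; near: n; exact: near_infty_natSinv_lt (PosNum e0).
  have [n Un] := @filter_ex _ _ _ _ (oU _ _ ((fcvg u x).1 ux) Ux).
  exact: (Pu n).2.
- have ugA : (fun n => g (N n)) @ \oo --> g A.
    apply: (fcvg (g \o N) (g A)).2; rewrite gK.
    by rewrite (_ : f \o (g \o N) = N)//; apply/funext => n /=; rewrite gK.
  have /ugA : nbhs (g A) (f @^-1` U)
    by apply: open_nbhs_nbhs; split => //=; rewrite gK.
  rewrite /= nbhs_filterE => -[k kI kU]; exists k => // n /kU /=; by rewrite gK.
Unshelve. all: by end_near. Qed.

End Operators.

Record star_isomorphism (R : realType) (H K : hilbertType R)
    (M : set (H -> H)) (N : set (K -> K)) (phi : (H -> H) -> (K -> K)) : Prop := {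
  star_iso_bij : set_bij M N phi;
  star_isoD : forall S T, M S -> M T -> phi (S \+ T) = phi S \+ phi T;
  star_isoZ : forall (a : R[i]) T, M T -> phi (a \*: T) = a \*: phi T;
  star_isoM : forall S T, M S -> M T -> phi (S \o T) = phi S \o phi T;
  star_iso_adjoint : forall T S, M T -> adjoint T S ->
    adjoint (phi T) (phi S) }.

(* A star-isomorphism of von Neumann algebras is automatically normal and, here,
   unital. *)
Definition contains_vN (R : realType) (H K : hilbertType R)
    (M : set (H -> H)) (L : set (K -> K)) :=
  exists (N : SubAlg M) (phi : (K -> K) -> (H -> H)), star_isomorphism L N phi.

(* Main.v *)
(* Fix a projection p in M, p <> 0, 1, and projections q_n <= p in M with q_n -> p/2
   weakly. If a subsequence of the algebras span(1, q_n) converged, p/2 would lie in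
   its limsup, hence in its liminf: a_n + b_n q_n -> p/2 strongly. Evaluating at a
   vector of ker p gives a_n -> 0, and then <b_n q_n eta, eta>^2 is at most
   |b_n q_n eta|^2 |q_n eta|^2, which at eta = p eta reads 1/4 <= 1/8 in the limit.
   The algebras span(1, q_n) therefore have no cluster point.

   The projections q_n come from a hermitian a in the copy of L(Z), the image of
   (u + u^-1)/4 for the bilateral shift u. Since u + u^-1 has no eigenvector in l^2(Z),
   no nonzero projection e of {a}'' satisfies a e = l e; as this is purely algebraic, no
   normality of the embedding is needed. Call e halvable, for test vectors x and
   eps > 0, if some q <= e has sum_x <(2q - e)x, x>^2 <= eps sum_x <e x, x>. If e1 and
   e2 are orthogonal and halvable then so is e1 + e2, since the sign of 2q - e2 may be
   chosen freely. Hence bisecting the spectrum of a below a projection that is not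
   halvable yields a decreasing sequence of projections that are not halvable; these satisfy
   sum_x <e x, x> > eps, so their limit is a nonzero eigenprojection of a, which is
   absurd. The spectral projections of a are obtained from Newton's iteration for the
   sign of a - m. Separability of the predual reduces weak convergence to countably
   many test vectors. *)
Require Import Defs.
From mathcomp Require Import all_boot all_order all_algebra.
From mathcomp Require Import sesquilinear complex.
From mathcomp Require Import all_classical all_reals all_analysis.
From mathcomp Require Import ring lra.

Set Implicit Arguments.
Unset Strict Implicit.
Unset Printing Implicit Defensive.

Import Order.TTheory GRing.Theory Num.Theory.
Import numFieldNormedType.Exports.
Import ComplexField.Normc.

Local Open Scope classical_set_scope.
Local Open Scope ring_scope.
Local Open Scope complex_scope.

(** * The real inner product underlying that of [H] *)

Section RealInner.
Context {R : realType} {H : hilbertType R}.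
Implicit Types (x y z : H) (c : R) (T S : H -> H) (u : nat -> H).

Lemma innerC x y : inner x y = (inner y x)^*%C.
Proof. by rewrite hermC expr0 mul1r. Qed.

Lemma innerDl x y z : inner (x + y) z = inner x z + inner y z.
Proof. exact: linearDl. Qed.

Lemma innerDr x y z : inner z (x + y) = inner z x + inner z y.
Proof. exact: linearDr. Qed.

Lemma innerBl x y z : inner (x - y) z = inner x z - inner y z.
Proof. exact: linearBl. Qed.

Lemma innerZl (a : R[i]) x y : inner (a *: x) y = a * inner x y.
Proof. exact: linearZl_LR. Qed.

Lemma innerZr (a : R[i]) x y : inner x (a *: y) = a^*%C * inner x y.
Proof. exact: linearZr_LR. Qed.

(** Estimates are carried out with this real inner product, whose values are totally ordered;
    [inner_rdot] recovers the complex one. *)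
Definition rdot x y : R := complex.Re (inner x y).

Lemma rdotC x y : rdot x y = rdot y x.
Proof. by rewrite /rdot innerC; case: (inner y x). Qed.

Lemma rdotDl x y z : rdot (x + y) z = rdot x z + rdot y z.
Proof. by rewrite /rdot innerDl raddfD. Qed.

Lemma rdotDr x y z : rdot z (x + y) = rdot z x + rdot z y.
Proof. by rewrite rdotC rdotDl !(rdotC z). Qed.

Lemma rdotZl c x y : rdot (c%:C *: x) y = c * rdot x y.
Proof. by rewrite /rdot innerZl; case: (inner x y) => a b /=; rewrite mul0r subr0. Qed.

Lemma rdotZr c x y : rdot x (c%:C *: y) = c * rdot x y.
Proof. by rewrite rdotC rdotZl rdotC. Qed.

Lemma rdotNl x y : rdot (- x) y = - rdot x y.
Proof. by rewrite /rdot linearNl raddfN. Qed.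

Lemma rdotNr x y : rdot x (- y) = - rdot x y.
Proof. by rewrite rdotC rdotNl rdotC. Qed.

Lemma rdotBl x y z : rdot (x - y) z = rdot x z - rdot y z.
Proof. by rewrite rdotDl rdotNl. Qed.

Lemma rdotBr x y z : rdot z (x - y) = rdot z x - rdot z y.
Proof. by rewrite rdotDr rdotNr. Qed.

Lemma rdot0l x : rdot 0 x = 0.
Proof. by rewrite -(subrr x) rdotBl subrr. Qed.

Lemma rdot0r x : rdot x 0 = 0.
Proof. by rewrite rdotC rdot0l. Qed.

Lemma inner_rdot x y : inner x y = rdot x y +i* rdot x ('i%C *: y).
Proof.
rewrite /rdot innerZr; case: (inner x y) => a b /=.
by rewrite mul0r sub0r mulN1r opprK.
Qed.

Definition hnorm x : R := Num.sqrt (rdot x x).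

Lemma rdotxx x : (rdot x x)%:C = inner x x.
Proof.
rewrite inner_norm /rdot inner_norm RRe_real // rpredX // realE normr_ge0 //.
Qed.

Lemma rdot_ge0 x : 0 <= rdot x x.
Proof. by rewrite -ler0c rdotxx inner_norm exprn_ge0. Qed.

Lemma hnorm_sqr x : hnorm x ^+ 2 = rdot x x.
Proof. by rewrite sqr_sqrtr // rdot_ge0. Qed.

Lemma hnorm_ge0 x : 0 <= hnorm x.
Proof. exact: sqrtr_ge0. Qed.

Lemma normE x : `|x| = (hnorm x)%:C.
Proof.
apply/eqP; rewrite -(@eqrXn2 _ 2) ?ler0c ?hnorm_ge0 // -inner_norm -rdotxx.
by rewrite -hnorm_sqr rmorphXn.
Qed.

Lemma hnorm0_eq0 x : hnorm x = 0 -> x = 0.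
Proof. by move=> hx; apply/eqP; rewrite -normr_eq0 normE hx. Qed.

Lemma rdot_eq0 x : rdot x x = 0 -> x = 0.
Proof. by move=> hx; apply: hnorm0_eq0; rewrite /hnorm hx sqrtr0. Qed.

Lemma rdot_ext x y : (forall z, rdot x z = rdot y z) -> x = y.
Proof.
move=> xy; apply/eqP; rewrite -subr_eq0; apply/eqP/rdot_eq0.
by rewrite rdotBl xy subrr.
Qed.

Lemma ler_hnormD x y : hnorm (x + y) <= hnorm x + hnorm y.
Proof. by rewrite -lecR rmorphD /= -!normE ler_normD. Qed.

Lemma hnorm_opp x : hnorm (- x) = hnorm x.
Proof. by rewrite /hnorm rdotNl rdotNr opprK. Qed.

Lemma hnormBC x y : hnorm (x - y) = hnorm (y - x).
Proof. by rewrite -hnorm_opp opprB. Qed.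

Lemma hnormZ (a : R[i]) x : (hnorm (a *: x))%:C = `|a| * (hnorm x)%:C.
Proof. by rewrite -!normE normrZ. Qed.

Lemma rdot_CS x y : `|rdot x y| <= hnorm x * hnorm y.
Proof.
have [->|y0] := eqVneq y 0; first by rewrite rdot0r normr0 mulr_ge0 ?hnorm_ge0.
have ny : 0 < rdot y y.
  by rewrite lt_neqAle rdot_ge0 andbT eq_sym; apply: contra y0 => /eqP/rdot_eq0 ->.
rewrite -ler_sqr ?nnegrE ?mulr_ge0 ?hnorm_ge0 // exprMn !hnorm_sqr.
rewrite real_normK ?num_real //.
have := rdot_ge0 (x - (rdot x y / rdot y y)%:C *: y).
rewrite rdotBl !rdotBr !rdotZl !rdotZr (rdotC y x).
set a := rdot x x; set b := rdot x y; set c := rdot y y.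
have -> : a - b / c * b - (b / c * b - b / c * (b / c * c)) = (a * c - b ^+ 2) / c.
  by field; rewrite gt_eqF.
by rewrite pmulr_lge0 ?invr_gt0 // subr_ge0.
Qed.

Lemma cvg_hnorm (u : nat -> H) x :
  u n @[n --> \oo] --> x <-> hnorm (u n - x) @[n --> \oo] --> (0 : R).
Proof.
split => [/cvgrPdist_lt ux|/cvgrPdist_lt ux].
  apply/cvgrPdist_lt => e e0; have e0' : 0 < e%:C by rewrite ltcR.
  apply: filterS (ux _ e0') => n.
  by rewrite sub0r normrN ger0_norm ?hnorm_ge0 // normE ltcR hnormBC.
(* A positive element of R[i] has imaginary part 0, so [e] is real. *)
apply/cvgrPdist_lt => e; case: e => e1 e2; rewrite ltcE /= => /andP[/eqP -> e0].
apply: filterS (ux _ e0) => n.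
by rewrite sub0r normrN ger0_norm ?hnorm_ge0 // normE hnormBC -ltcR.
Qed.

Lemma hcvg_uniq (u : nat -> H) x y :
  u n @[n --> \oo] --> x -> u n @[n --> \oo] --> y -> x = y.
Proof.
move=> ux uy; rewrite -(cvg_lim (@norm_hausdorff _ _) ux).
by rewrite -(cvg_lim (@norm_hausdorff _ _) uy).
Qed.

Lemma rcvg_uniq (u : nat -> R) (a b : R) :
  u n @[n --> \oo] --> a -> u n @[n --> \oo] --> b -> a = b.
Proof.
by move=> ua ub; rewrite -(cvg_lim (@Rhausdorff _) ua) -(cvg_lim (@Rhausdorff _) ub).
Qed.

Lemma cauchy_hnorm (u : nat -> H) :
  (forall e : R, 0 < e -> exists N, forall m n, (N <= m)%N -> (N <= n)%N ->
     hnorm (u n - u m) < e) ->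
  exists x, u n @[n --> \oo] --> x.
Proof.
move=> uC; suff : cvg (u n @[n --> \oo]) by exists (lim (u n @[n --> \oo])).
apply/cauchy_cvgP/cauchyP => /= -[e1 e2]; rewrite ltcE /= => /andP[/eqP -> e0].
have [N uN] := uC _ e0; exists (u N); exists N => // n /= Nn.
by rewrite -ball_normE /= normE ltcR; exact: uN.
Qed.

Lemma cvg_rdot (u v : nat -> H) x y :
  u n @[n --> \oo] --> x -> v n @[n --> \oo] --> y ->
  rdot (u n) (v n) @[n --> \oo] --> rdot x y.
Proof.
move=> /cvg_hnorm ux /cvg_hnorm vy.
have h : hnorm (u n - x) * hnorm (v n - y) + hnorm x * hnorm (v n - y) +
    hnorm (u n - x) * hnorm y @[n --> \oo] --> (0 : R).
  rewrite [X in _ --> X](_ : 0 = 0 * 0 + hnorm x * 0 + 0 * hnorm y); last ring.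
  by apply: cvgD; [apply: cvgD; [exact: cvgM|exact: cvgMl_tmp]|exact: cvgMr_tmp].
apply/subr_cvg0; apply: norm_cvg0; apply: squeeze_cvgr (cvg_cst 0) h.
apply: nearW => n; rewrite normr_ge0 /=.
have -> : rdot (u n) (v n) - rdot x y =
  rdot (u n - x) (v n - y) + rdot x (v n - y) + rdot (u n - x) y.
  by rewrite !rdotBl !rdotBr; ring.
apply: le_trans (ler_normD _ _) _; apply: lerD (rdot_CS _ _).
by apply: le_trans (ler_normD _ _) _; apply: lerD; exact: rdot_CS.
Qed.

Lemma cvg_inner (u : nat -> H) x y :
  (forall y, rdot (u n) y @[n --> \oo] --> rdot x y) ->
  (inner (u n) y : R[i]^o) @[n --> \oo] --> (inner x y : R[i]^o).
Proof.
move=> ux; apply/cvgrPdist_lt => -[e1 e2]; rewrite ltcE /= => /andP[/eqP -> e0].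
have e2' : 0 < e1 / 2 by rewrite divr_gt0.
have /cvgrPdist_lt/(_ _ e2') h1 := ux y.
have /cvgrPdist_lt/(_ _ e2') h2 := ux ('i%C *: y).
near=> n; rewrite !inner_rdot.
set b := rdot x y; set c := rdot x _.
have -> : b +i* c - (rdot (u n) y +i* rdot (u n) ('i%C *: y)) =
  (b - rdot (u n) y)%:C + 'i%C * (c - rdot (u n) ('i%C *: y))%:C.
  by rewrite [LHS]complexE.
apply: le_lt_trans (ler_normD _ _) _.
rewrite normrM !normc_def /= expr0n expr1n add0r sqrtr1 mul1r addr0.
rewrite ?addr0 !sqrtr_sqr -rmorphD ltcR (splitr e1).
apply: ltrD; [near: n; exact: h1 | near: n; exact: h2].
Unshelve. all: by end_near. Qed.

End RealInner.

(** * Bounded operators, strong limits and commutants *)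

Section Operators.
Context {R : realType} {H : hilbertType R}.
Implicit Types (x y z : H) (c : R) (T S : H -> H) (A : set (H -> H)).

Lemma linD T : linear T -> {morph T : x y / x + y}.
Proof. by move=> lT x y; have := lT 1 x y; rewrite !scale1r. Qed.

Lemma lin0 T : linear T -> T 0 = 0.
Proof. by move=> lT; apply: (addrI (T 0)); rewrite -(linD lT) !addr0. Qed.

Lemma linZ T (a : R[i]) : linear T -> {morph T : x / a *: x}.
Proof. by move=> lT x; have := lT a x 0; rewrite (lin0 lT) !addr0. Qed.

Lemma linN T : linear T -> {morph T : x / - x}.
Proof. by move=> lT x; rewrite -scaleN1r (linZ _ lT) scaleN1r. Qed.

Lemma linB T : linear T -> {morph T : x y / x - y}.
Proof. by move=> lT x y; rewrite linD // linN. Qed.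

Lemma linear_bounded_op T C :
  linear T -> (forall x, hnorm (T x) <= C * hnorm x) -> bounded_op T.
Proof.
move=> lT bT; split=> // x; apply/cvgrPdist_lt => -[e1 e2].
rewrite ltcE /= => /andP[/eqP -> e0].
have C0 : 0 < `|C| + 1 by rewrite ltr_wpDl.
have d0 : 0 < (e1 / (`|C| + 1))%:C by rewrite ltcR divr_gt0.
have xx : y @[y --> x] --> x by exact: cvg_id.
have /cvgrPdist_lt/(_ _ d0) := xx; apply: filterS => y.
rewrite -(linB lT) !normE !ltcR ltr_pdivlMr // => h.
apply: le_lt_trans (bT _) _; apply: le_lt_trans h; rewrite mulrC.
by rewrite ler_wpM2l ?hnorm_ge0 // (le_trans (ler_norm _)) // lerDl.
Qed.

Lemma contraction_bounded_op T :
  linear T -> (forall x, hnorm (T x) <= hnorm x) -> bounded_op T.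
Proof. by move=> lT bT; apply: (@linear_bounded_op T 1) => // x; rewrite mul1r. Qed.

Lemma bounded_op_cvg T (u : nat -> H) x : bounded_op T ->
  u n @[n --> \oo] --> x -> T (u n) @[n --> \oo] --> T x.
Proof. by move=> [_ cT] ux; apply: continuous_cvg => //; exact: cT. Qed.

(** The increments of the bounded nondecreasing sequence [g n x] dominate the squared distances, so
    [s n x] is Cauchy. This yields the sign of an operator, limits of decreasing projections and
    partial isometries alike. *)
Lemma strong_limit (s : nat -> H -> H) (g : nat -> H -> R) :
  (forall n, linear (s n)) ->
  (forall n x, hnorm (s n x) <= hnorm x) ->
  (forall x m n, (m <= n)%N ->
     rdot (s n x - s m x) (s n x - s m x) <= g n x - g m x) ->
  (forall x, exists B, forall n, g n x <= B) ->
  exists t, [/\ bounded_op t, forall x, hnorm (t x) <= hnorm x &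
    forall x, s n x @[n --> \oo] --> t x].
Proof.
move=> ls bs sg gB.
have /choice[t st] x : exists y, s n x @[n --> \oo] --> y.
  apply: cauchy_hnorm => e e0.
  have gnd : nondecreasing_seq (g ^~ x).
    move=> m n mn; rewrite -subr_ge0; apply: le_trans (sg _ _ _ mn).
    exact: rdot_ge0.
  have [B gxB] := gB x.
  have /cvg_ex[/= l /cvgrPdist_lt gl] : cvgn (g ^~ x).
    by apply: nondecreasing_is_cvgn => //; exists B => _ [n _ <-].
  have e2 : 0 < e ^+ 2 / 2 by rewrite divr_gt0 // exprn_gt0.
  have [N _ Ng] := gl _ e2; exists N.
  have wl m n : (N <= m)%N -> (m <= n)%N -> hnorm (s n x - s m x) < e.
    move=> Nm mn; rewrite -ltr_sqr ?nnegrE ?hnorm_ge0 ?(ltW e0) // hnorm_sqr.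
    apply: le_lt_trans (sg _ _ _ mn) _.
    have /ltr_distlDr := Ng _ Nm; have /ltr_distlCDr := Ng _ (leq_trans Nm mn).
    lra.
  move=> m n Nm Nn; case/orP: (leq_total m n) => mn; first exact: wl.
  by rewrite hnormBC; exact: wl.
have lt : linear t.
  move=> a x y; apply: hcvg_uniq (st _) _.
  under eq_fun => n do rewrite ls.
  by apply: cvgD => //; exact: cvgZl_tmp.
have bt x : hnorm (t x) <= hnorm x.
  rewrite -ler_sqr ?nnegrE ?hnorm_ge0 // !hnorm_sqr.
  apply: ler_cvg_to (cvg_rdot (st x) (st x)) (cvg_cst _) _.
  apply: nearW => n; rewrite -!hnorm_sqr ler_sqr ?nnegrE ?hnorm_ge0 //.
exists t; split=> //; exact: contraction_bounded_op.
Qed.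

Lemma bounded_op_comp T S : bounded_op T -> bounded_op S -> bounded_op (T \o S).
Proof.
move=> [lT cT] [lS cS]; split; first by move=> a x y /=; rewrite lS lT.
by move=> x; apply: continuous_comp; [exact: cS|exact: cT].
Qed.

Lemma bounded_op_lin (a : R[i]) T S :
  bounded_op T -> bounded_op S -> bounded_op ((a \*: T) \+ S).
Proof.
move=> [lT cT] [lS cS]; split.
  move=> b x y /=; rewrite lT lS !scalerDr !scalerA (mulrC a b).
  by rewrite -!addrA; congr (_ + _); rewrite addrCA.
by move=> x; apply: cvgD; [apply: cvgZl_tmp; exact: cT|exact: cS].
Qed.

Lemma bounded_op_id : bounded_op (@idfun H).
Proof. by split=> // x; exact: cvg_id. Qed.

Lemma commutantP A T :
  commutant A T <-> bounded_op T /\ forall S, A S -> forall x, T (S x) = S (T x).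
Proof.
split=> -[bT TA]; split=> // S /TA; last by move=> e; apply/funext.
by move=> e x; have := congr1 (@^~ x) e.
Qed.

Lemma commutant_comp A T S : commutant A T -> commutant A S -> commutant A (T \o S).
Proof.
move=> /commutantP[bT TA] /commutantP[bS SA]; apply/commutantP; split.
  exact: bounded_op_comp.
by move=> U AU x /=; rewrite SA // TA.
Qed.

Lemma commutant_lin A (a : R[i]) T S : (forall U, A U -> bounded_op U) ->
  commutant A T -> commutant A S -> commutant A ((a \*: T) \+ S).
Proof.
move=> bA /commutantP[bT TA] /commutantP[bS SA]; apply/commutantP; split.
  exact: bounded_op_lin.
by move=> U AU x /=; rewrite (bA _ AU).1 TA // SA.
Qed.

Lemma commutant_id A : commutant A idfun.
Proof. by apply/commutantP; split=> //; exact: bounded_op_id. Qed.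

Lemma commutant_cvg A (s : nat -> H -> H) T : (forall U, A U -> bounded_op U) ->
  bounded_op T -> (forall n, commutant A (s n)) ->
  (forall x, s n x @[n --> \oo] --> T x) -> commutant A T.
Proof.
move=> bA bT sA sT; apply/commutantP; split=> // U AU x.
apply: hcvg_uniq (sT _) _.
have sU n : s n (U x) = U (s n x) by case/commutantP: (sA n) => _ ->.
under eq_fun => n do rewrite sU.
exact: bounded_op_cvg (bA _ AU) (sT x).
Qed.

Lemma commutant_bounded A T : commutant A T -> bounded_op T.
Proof. by case. Qed.

Lemma commutantS A B : A `<=` B -> commutant B `<=` commutant A.
Proof. by move=> AB T [bT TB]; split=> // S /AB; exact: TB. Qed.

Lemma sub_bicommutant A : (forall U, A U -> bounded_op U) -> A `<=` commutant (commutant A).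
Proof.
move=> bA T AT; apply/commutantP; split; first exact: bA.
by move=> S /commutantP[_ SA] x; rewrite SA.
Qed.

End Operators.

(** * Newton's iteration with nonnegative coefficients *)

Section Nonneg.
Context {R : realType}.
Implicit Types p q : {poly R}.

(** Such a polynomial takes a positive operator to a positive operator ([opeval_ge0]), so
    inequalities between polynomials in an operator can be read off coefficients, without a
    functional calculus. *)
Definition nonneg_poly p := forall i, 0 <= p`_i.

Lemma nonneg_polyD p q : nonneg_poly p -> nonneg_poly q -> nonneg_poly (p + q).
Proof. by move=> hp hq i; rewrite coefD addr_ge0. Qed.

Lemma nonneg_polyM p q : nonneg_poly p -> nonneg_poly q -> nonneg_poly (p * q).
Proof. by move=> hp hq i; rewrite coefM sumr_ge0 // => j _; rewrite mulr_ge0. Qed.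

Lemma nonneg_polyC c : 0 <= c -> nonneg_poly c%:P.
Proof. by move=> c0 i; rewrite coefC; case: ifP. Qed.

Lemma nonneg_poly1 : nonneg_poly 1.
Proof. exact: nonneg_polyC. Qed.

Lemma nonneg_polyX : nonneg_poly 'X.
Proof. by move=> i; rewrite coefX; case: eqP. Qed.

Definition poly_half : {poly R} := (2^-1)%:P.

Lemma half2 : poly_half * 2 = 1.
Proof. by rewrite /poly_half -(polyC_natr _ 2) -polyCM mulVf ?pnatr_eq0. Qed.

Lemma nonneg_half : nonneg_poly poly_half.
Proof. by apply: nonneg_polyC; rewrite invr_ge0. Qed.

(* Newton's iteration for (1 - 'X)^(-1/2); [isqrt_err n] is its relative error. *)
Fixpoint isqrt n : {poly R} :=
  if n is m.+1 then isqrt m * (1 + poly_half * (1 - (1 - 'X) * isqrt m ^+ 2)) else 1.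

Definition isqrt_err n : {poly R} := 1 - (1 - 'X) * isqrt n ^+ 2.

(** For d the error at stage n, 1 - (1 - d)(1 + d/2)^2 = (3 d^2 + d^3)/4. The coefficients on the
    right are nonnegative, so positivity passes from one error to the next. *)
Lemma isqrt_errS n :
  isqrt_err n.+1 = poly_half ^+ 2 * (isqrt_err n ^+ 2 *+ 3 + isqrt_err n ^+ 3).
Proof.
have -> : isqrt_err n.+1 = 1 - (1 - isqrt_err n) * (1 + poly_half * isqrt_err n) ^+ 2.
  by rewrite {1 2}/isqrt_err subKr {1}/isqrt_err /= exprMn mulrA.
move: (isqrt_err n) => d; have := half2; move: poly_half => h h2.
apply/eqP; rewrite -subr_eq0; apply/eqP.
(* With h a free variable the difference is a multiple of 1 - 2 h; the value 1/2 of h enters only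
   afterwards. *)
have -> : 1 - (1 - d) * (1 + h * d) ^+ 2 - h ^+ 2 * (d ^+ 2 *+ 3 + d ^+ 3) =
  (1 - h * 2) * (d + 2 * h * d ^+ 2) by ring.
by rewrite h2 subrr mul0r.
Qed.

Lemma nonneg_isqrt_err n : nonneg_poly (isqrt_err n).
Proof.
elim: n => [|n IH].
  by rewrite /isqrt_err /= expr1n mulr1 opprB addrC subrK; exact: nonneg_polyX.
rewrite isqrt_errS -mulr_natl -(polyC_natr _ 3).
apply: nonneg_polyM; first by apply: nonneg_polyM; exact: nonneg_half.
apply: nonneg_polyD.
  by apply: nonneg_polyM; [exact: nonneg_polyC|exact: nonneg_polyM].
by apply: nonneg_polyM => //; exact: nonneg_polyM.
Qed.

Lemma isqrtS n : isqrt n.+1 = isqrt n + isqrt n * (poly_half * isqrt_err n).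
Proof. by rewrite /= mulrDr mulr1. Qed.

Lemma nonneg_isqrt n : nonneg_poly (isqrt n).
Proof.
elim: n => [|n IH]; first exact: nonneg_poly1.
rewrite isqrtS; apply: nonneg_polyD => //; apply: nonneg_polyM => //.
by apply: nonneg_polyM; [exact: nonneg_half|exact: nonneg_isqrt_err].
Qed.

Lemma nonneg_isqrtB m n : (m <= n)%N -> nonneg_poly (isqrt n - isqrt m).
Proof.
elim: n => [|n IH]; first by rewrite leqn0 => /eqP -> i; rewrite subrr coef0.
rewrite leq_eqVlt => /orP[/eqP <- i|mn]; first by rewrite subrr coef0.
rewrite isqrtS addrAC; apply: nonneg_polyD; first exact: IH.
apply: nonneg_polyM; first exact: nonneg_isqrt.
by apply: nonneg_polyM; [exact: nonneg_half|exact: nonneg_isqrt_err].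
Qed.

End Nonneg.

(** * Real polynomials in an operator *)

Section PolyEval.
Context {R : realType} {H : hilbertType R}.
Variable D : H -> H.
Hypothesis lD : linear D.
Implicit Types (p q : {poly R}) (x y : H).

Definition opeval p x : H := \sum_(i < size p) (p`_i)%:C *: iter i D x.

Lemma opevalE n p x : (size p <= n)%N ->
  opeval p x = \sum_(i < n) (p`_i)%:C *: iter i D x.
Proof.
move=> pn; rewrite /opeval (big_ord_widen _ (fun i => (p`_i)%:C *: iter i D x) pn).
rewrite big_mkcond; apply: eq_bigr => i _; case: ltnP => // ip.
by rewrite nth_default // scale0r.
Qed.

Lemma iter_linear n : linear (iter n D).
Proof. by move=> a x y; elim: n => //= n ->; rewrite lD. Qed.

Lemma opeval_linear p : linear (opeval p).
Proof.
move=> a x y; rewrite /opeval scaler_sumr -big_split /=; apply: eq_bigr => i _.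
by rewrite iter_linear scalerDr !scalerA (mulrC a).
Qed.

Lemma opevalD p q x : opeval (p + q) x = opeval p x + opeval q x.
Proof.
have hs := size_polyD p q; rewrite (opevalE _ hs).
rewrite (opevalE _ (leq_maxl (size p) (size q))).
rewrite (opevalE _ (leq_maxr (size p) (size q))) -big_split.
by apply: eq_bigr => i _; rewrite coefD rmorphD scalerDl.
Qed.

Lemma opevalC c x : opeval c%:P x = c%:C *: x.
Proof.
by rewrite (@opevalE 1) ?size_polyC_leq1 // big_ord1 coefC.
Qed.

Lemma opeval1 x : opeval 1 x = x.
Proof. by rewrite opevalC scale1r. Qed.

Lemma opevalCM c p x : opeval (c%:P * p) x = c%:C *: opeval p x.
Proof.
rewrite mul_polyC (opevalE _ (size_scale_leq c p)) scaler_sumr.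
by apply: eq_bigr => i _; rewrite coefZ rmorphM scalerA.
Qed.

Lemma opevalN p x : opeval (- p) x = - opeval p x.
Proof. by rewrite -mulN1r -polyCN opevalCM rmorphN1 scaleN1r. Qed.

Lemma opevalB p q x : opeval (p - q) x = opeval p x - opeval q x.
Proof. by rewrite opevalD opevalN. Qed.

Lemma opevalMX p x : opeval (p * 'X) x = opeval p (D x).
Proof.
rewrite (@opevalE (size p).+1); last first.
  by have [->|p0] := eqVneq p 0; [rewrite mul0r size_poly0|rewrite size_mulX].
rewrite big_ord_recl coefMX eqxx scale0r add0r; apply: eq_bigr => i _.
by rewrite coefMX /= -iterSr.
Qed.

Lemma opevalX x : opeval 'X x = D x.
Proof. by rewrite -[X in opeval X]mul1r opevalMX opeval1. Qed.

Lemma opeval_comm S p x : linear S -> (forall y, S (D y) = D (S y)) ->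
  S (opeval p x) = opeval p (S x).
Proof.
move=> lS SD; elim/poly_ind: p x => [|p c IH] x.
  by rewrite !opevalC !scale0r lin0.
by rewrite !opevalD !opevalMX !opevalC (linD lS) (linZ _ lS) IH SD.
Qed.

Lemma opevalM p q x : opeval (p * q) x = opeval p (opeval q x).
Proof.
elim/poly_ind: p x => [|p c IH] x; first by rewrite mul0r !opevalC !scale0r.
rewrite mulrDl opevalD opevalCM opevalD opevalC mulrAC !opevalMX IH.
by rewrite (@opeval_comm D).
Qed.

Hypothesis hD : forall x y, rdot (D x) y = rdot x (D y).

Lemma rdot_iter n x y : rdot (iter n D x) y = rdot x (iter n D y).
Proof. by elim: n x y => //= n IH x y; rewrite hD IH -iterSr. Qed.

Lemma opeval_herm p x y : rdot (opeval p x) y = rdot x (opeval p y).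
Proof.
elim/poly_ind: p x => [|p c IH] x; first by rewrite !opevalC !rmorph0 !scale0r rdot0l rdot0r.
rewrite !opevalD !opevalMX !opevalC rdotDl rdotDr rdotZl rdotZr IH hD.
by rewrite (@opeval_comm D).
Qed.

Hypothesis D_ge0 : forall x, 0 <= rdot (D x) x.

(** The powers D^(2j) = D^j D^j and D^(2j+1) = D^j D D^j are positive because D is hermitian and
    positive. *)
Lemma opeval_ge0 p x : nonneg_poly p -> 0 <= rdot (opeval p x) x.
Proof.
move=> p0; rewrite /opeval; elim/big_ind: _ => [|y z y0 z0|i _]; first by rewrite rdot0l.
  by rewrite rdotDl addr_ge0.
rewrite rdotZl mulr_ge0 //.
rewrite -(odd_double_half i) -addnn; case: (odd i); last first.
  by rewrite /= add0n iterD rdot_iter rdot_ge0.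
have -> : iter (true + (i./2 + i./2))%N D x = iter i./2 D (iter i./2.+1 D x).
  by rewrite -iterD addnS.
by rewrite rdot_iter; exact: D_ge0.
Qed.

End PolyEval.

(** * The sign and a spectral projection of a hermitian contraction *)

Section SignProjection.
Context {R : realType} {H : hilbertType R}.
Variable T : H -> H.
Hypothesis lT : linear T.
Hypothesis hT : forall x y, rdot (T x) y = rdot x (T y).
Hypothesis cT : forall x, hnorm (T x) <= hnorm x.
Implicit Types (p q : {poly R}) (x y : H).

(** For a hermitian contraction T, D = 1 - T^2 is positive, and (1 - D)^(-1/2) is formally 1/|T|. *)
Let D x := x - T (T x).

Let lD : linear D.
Proof.
by move=> a x y; rewrite /D !lT scalerBr opprD addrACA.
Qed.

Let hD x y : rdot (D x) y = rdot x (D y).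
Proof. by rewrite /D rdotBl rdotBr !hT. Qed.

Let D_ge0 x : 0 <= rdot (D x) x.
Proof.
rewrite /D rdotBl hT -!hnorm_sqr subr_ge0.
by rewrite ler_sqr ?nnegrE ?hnorm_ge0.
Qed.

Local Notation ev := (opeval D).
Local Notation Q p x := (rdot (opeval D p x) x).

Let evT p x : T (ev p x) = ev p (T x).
Proof. by apply: opeval_comm => // y; rewrite /D linB. Qed.

Let QB p q x : Q (p - q) x = Q p x - Q q x.
Proof. by rewrite opevalB rdotBl. Qed.

Let Q_ge0 p x : nonneg_poly p -> 0 <= Q p x.
Proof. exact: opeval_ge0. Qed.

Let ev1X x : ev (1 - 'X) x = T (T x).
Proof. by rewrite opevalB opeval1 opevalX // /D opprB addrC subrK. Qed.

Let Q1X p x : Q ((1 - 'X) * p) x = Q p (T x).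
Proof. by rewrite opevalM // ev1X hT evT. Qed.

Let Qsqr p q x : Q (q ^+ 2 * p) x = Q p (ev q x).
Proof.
by rewrite expr2 -mulrA !opevalM // opeval_herm // -!opevalM // mulrC opevalM.
Qed.

Let Q1 x : Q 1 x = rdot x x.
Proof. by rewrite opeval1. Qed.

(** [s n] approximates T/|T|, and [g n] is the quadratic form of its square T^2 [isqrt n](D)^2. *)
Let s n x := T (ev (isqrt n) x).
Let g n x := Q ((1 - 'X) * isqrt n ^+ 2) x.

Let rdotT p x : rdot (T (ev p x)) (T (ev p x)) = Q ((1 - 'X) * p ^+ 2) x.
Proof. by rewrite Q1X -[p ^+ 2]mulr1 Qsqr Q1 evT. Qed.

Let Q_isqrt_err n x : Q (isqrt_err n) x = rdot x x - g n x.
Proof. by rewrite /isqrt_err QB Q1. Qed.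

(** Writing p_n for [isqrt n], (p_n^2 - p_m^2) - (p_n - p_m)^2 = 2 p_m (p_n - p_m), whose
    coefficients are nonnegative. The remaining factor 1 - 'X evaluates to T^2 and is absorbed into
    the vector by [Q1X]. *)
Let sB x m n : (m <= n)%N ->
  rdot (s n x - s m x) (s n x - s m x) <= g n x - g m x.
Proof.
move=> mn; rewrite /s -(linB lT) -opevalB rdotT -subr_ge0 /g -!QB.
rewrite [X in opeval D X](_ : _ =
   (1 - 'X) * (isqrt m * (isqrt n - isqrt m) + isqrt m * (isqrt n - isqrt m))); last by ring.
rewrite Q1X; apply: Q_ge0; apply: nonneg_polyD; apply: nonneg_polyM;
  by [exact: nonneg_isqrt|exact: nonneg_isqrtB].
Qed.

Let s_le n x : hnorm (s n x) <= hnorm x.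
Proof.
rewrite -ler_sqr ?nnegrE ?hnorm_ge0 // !hnorm_sqr rdotT -subr_ge0 -Q_isqrt_err.
by apply: Q_ge0; exact: nonneg_isqrt_err.
Qed.

Let s_linear n : linear (s n).
Proof. by move=> a x y; rewrite /s opeval_linear // lT. Qed.

(** This makes T times the error of the iteration tend to 0 strongly, since the increments of a
    convergent sequence do. With d the error and d' the next one, the chain is T^2 d^2 <= (1 - d)
    d^2 <= d - d'. *)
Let T_err n x : rdot (T (ev (isqrt_err n) x)) (T (ev (isqrt_err n) x)) <=
  g n.+1 x - g n x.
Proof.
have Sge : Q ((1 - isqrt_err n) * isqrt_err n ^+ 2) x <= g n.+1 x - g n x.
  have -> : g n.+1 x - g n x = Q (isqrt_err n) x - Q (isqrt_err n.+1) x.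
    by rewrite !Q_isqrt_err; ring.
  rewrite -QB -subr_ge0 -QB isqrt_errS.
  (* The difference d - d' - (1 - d) d^2 equals (1 - d)^2 d + (1 - d) d^2/4. The first term is a
     square times d; the second is T^2 times a square, because 1 - d = (1 - 'X) [isqrt n]^2. *)
  have -> : isqrt_err n - poly_half ^+ 2 * (isqrt_err n ^+ 2 *+ 3 + isqrt_err n ^+ 3) -
      (1 - isqrt_err n) * isqrt_err n ^+ 2 =
      (1 - isqrt_err n) ^+ 2 * isqrt_err n +
      (1 - 'X) * ((isqrt n * (poly_half * isqrt_err n)) ^+ 2 * 1) :> {poly R}.
    have e : (1 - 'X) * isqrt n ^+ 2 = 1 - isqrt_err n :> {poly R} by rewrite /isqrt_err; ring.
    have -> : (1 - 'X) * ((isqrt n * (poly_half * isqrt_err n)) ^+ 2 * 1) =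
      (1 - isqrt_err n) * (poly_half * isqrt_err n) ^+ 2 :> {poly R} by rewrite -e; ring.
    move: (isqrt_err n) => d {e}.
    have := @half2 R; move: poly_half => h h2.
    apply/eqP; rewrite -subr_eq0; apply/eqP.
    rewrite [LHS](_ : _ = (1 - h * 2) * ((1 + h * 2) * d ^+ 2)); last by ring.
    by rewrite h2 subrr mul0r.
  rewrite opevalD rdotDl Qsqr addr_ge0 //; first exact/Q_ge0/nonneg_isqrt_err.
  by rewrite Q1X Qsqr Q1 rdot_ge0.
apply: le_trans Sge; rewrite rdotT -subr_ge0 -QB.
(* Here p_n^2 - 1 = (p_n + 1)(p_n - p_0), as p_0 = 1. *)
have -> : (1 - isqrt_err n) * isqrt_err n ^+ 2 - (1 - 'X) * isqrt_err n ^+ 2 =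
   (1 - 'X) * (isqrt_err n ^+ 2 * (isqrt n + 1) * (isqrt n - isqrt 0)) :> {poly R}.
  by rewrite {1}/isqrt_err /=; ring.
rewrite Q1X; apply: Q_ge0; apply: nonneg_polyM; last exact: nonneg_isqrtB.
apply: nonneg_polyM; last exact: nonneg_polyD (nonneg_isqrt _) (@nonneg_poly1 _).
by apply: nonneg_polyM; exact: nonneg_isqrt_err.
Qed.

(* The strong limit of [s] is sign(T), with sign(0) = 0. *)
Lemma sign_op : exists t, [/\ commutant (commutant [set T]) t,
  forall x y, rdot (t x) y = rdot x (t y),
  forall x, t (t (T x)) = T x, forall x, t (t (t x)) = t x &
  forall x, 0 <= rdot (T (t x)) x].
Proof.
have gB x : exists B, forall n, g n x <= B.
  exists (rdot x x) => n; rewrite -subr_ge0 -Q_isqrt_err.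
  by apply: Q_ge0; exact: nonneg_isqrt_err.
have [t [bt ct st]] := strong_limit s_linear s_le sB gB.
have bT := contraction_bounded_op lT cT.
have ht x y : rdot (t x) y = rdot x (t y).
  have hs n : rdot (s n x) y = rdot x (s n y) by rewrite /s hT opeval_herm // -evT.
  have e1 : rdot (s n x) y @[n --> \oo] --> rdot (t x) y.
    exact: cvg_rdot (st x) (cvg_cst y).
  apply: rcvg_uniq e1 _; under eq_fun => n do rewrite hs.
  exact: cvg_rdot (cvg_cst x) (st y).
have tT x : t (T x) = T (t x).
  apply: hcvg_uniq (st _) _; rewrite /s; under eq_fun => n do rewrite -evT.
  exact: bounded_op_cvg bT (st x).
(* T applied to the error is T (1 - [s n]^2), which tends to T (1 - t^2); by [T_err] it also tends
   to 0. *)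
have Tt2 x : T (t (t x)) = T x.
  apply/eqP; rewrite eq_sym -subr_eq0; apply/eqP/rdot_eq0; rewrite -(linB lT).
  have sst : s n (s n x) @[n --> \oo] --> t (t x).
    have h : hnorm (s n x - t x) + hnorm (s n (t x) - t (t x)) @[n --> \oo] --> (0 : R).
      rewrite -[X in _ --> X](addr0 (0 : R)).
      by apply: cvgD; apply/cvg_hnorm; exact: st.
    apply/cvg_hnorm; apply: squeeze_cvgr (cvg_cst 0) h.
    apply: nearW => n; rewrite hnorm_ge0 /=.
    have -> : s n (s n x) - t (t x) = s n (s n x - t x) + (s n (t x) - t (t x)).
      by rewrite (linB (s_linear n)) addrA subrK.
    have hh := ler_hnormD (s n (s n x - t x)) (s n (t x) - t (t x)).
    by apply: (le_trans hh); rewrite lerD2r.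
  have gx : g n x @[n --> \oo] --> rdot (t x) (t x).
    have gE n : g n x = rdot (s n x) (s n x) by rewrite /s rdotT.
    by under eq_fun => n do rewrite gE; exact: cvg_rdot.
  have gx1 : g n.+1 x - g n x @[n --> \oo] --> (0 : R).
    by rewrite -(subrr (rdot (t x) (t x))); apply: cvgB => //; rewrite (cvg_shiftS (g ^~ x)).
  have lim1 : T (ev (isqrt_err n) x) @[n --> \oo] --> T (x - t (t x)).
    have eE n : ev (isqrt_err n) x = x - s n (s n x).
      by rewrite /isqrt_err opevalB opeval1 opevalM // ev1X expr2 opevalM // /s !evT.
    apply: bounded_op_cvg bT _; under eq_fun => n do rewrite eE.
    by apply: cvgB; [exact: cvg_cst|exact: sst].
  have lim0 : rdot (T (ev (isqrt_err n) x)) (T (ev (isqrt_err n) x)) @[n --> \oo]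
      --> rdot (T (x - t (t x))) (T (x - t (t x))) by exact: cvg_rdot.
  apply: rcvg_uniq lim0 _.
  apply: squeeze_cvgr (cvg_cst 0) gx1; apply: nearW => n.
  by rewrite rdot_ge0 T_err.
exists t; split=> //.
- apply: (@commutant_cvg _ _ _ s) => //; first by move=> U; exact: commutant_bounded.
  move=> n; apply/commutantP; split.
    exact: contraction_bounded_op.
  move=> S /commutantP[bS ST] x.
  have STy y : S (T y) = T (S y) by exact: ST.
  rewrite /s STy (opeval_comm _ _ bS.1) // => y.
  by rewrite /D (linB bS.1) !STy.
- by move=> x; rewrite !tT Tt2.
- move=> x; apply: hcvg_uniq _ (st x).
  (* [s n x] lies in the range of T, where t^2 = 1; passing to the limit gives t^3 = t. *)
  have tts n : t (t (s n x)) = s n x by rewrite /s !tT Tt2.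
  under eq_fun => n do rewrite -tts.
  exact: bounded_op_cvg (bounded_op_comp bt bt) (st x).
(* T [s n] = T [isqrt n](D) T is positive. *)
move=> x; apply: ler_cvg_to (cvg_cst 0) (cvg_rdot (bounded_op_cvg bT (st x)) (cvg_cst x)) _.
apply: nearW => n /=; rewrite /s -ev1X -opevalM // Q1X.
by apply: Q_ge0; exact: nonneg_isqrt.
Qed.

Lemma sign_projection : exists q : H -> H, [/\ commutant (commutant [set T]) q,
  forall x y, rdot (q x) y = rdot x (q y), forall x, q (q x) = q x,
  forall x, 0 <= rdot (T (q x)) (q x) &
  forall x, rdot (T (x - q x)) (x - q x) <= 0].
Proof.
have [t [Wt ht t2T t3 Tt]] := sign_op.
have bc U : commutant [set T] U -> bounded_op U := @commutant_bounded _ _ _ _.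
have lt : linear t := (commutant_bounded Wt).1.
have tT x : t (T x) = T (t x).
  have /commutantP[_ h] := Wt; apply: h; apply/commutantP; split.
    exact: contraction_bounded_op.
  by move=> _ -> .
(* q = 1 - (t^2 - t)/2 equals 1, 1, 0 where the sign t equals 1, 0, -1: it is the spectral
   projection of T for [0, +oo). Hence T t q = T q and T t (1 - q) = - T (1 - q), and both sign
   conditions follow from T t >= 0. *)
pose q := ((- 2^-1 : R)%:C \*: (((-1) \*: t) \+ (t \o t))) \+ idfun.
have qE x : q x = (- 2^-1 : R)%:C *: (t (t x) - t x) + x.
  by rewrite /q /= scaleN1r [- t x + _]addrC.
have Ttt x : T (t (t x)) = T x by rewrite -!tT t2T.
have TqE x : T (q x) = (2^-1 : R)%:C *: (T x + T (t x)).
  rewrite qE lT (linB lT) Ttt; apply: rdot_ext => z.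
  by rewrite !(rdotDl, rdotNl, rdotZl); field.
have TtqE x : T (t (q x)) = T (q x).
  by rewrite -tT TqE (linZ _ lt) (linD lt) -!tT t2T addrC.
have Tt1q x : T (t (x - q x)) = - T (x - q x).
  rewrite (linB lt) !(linB lT) TtqE TqE; apply: rdot_ext => z.
  by rewrite !(rdotDl, rdotNl, rdotZl); field.
have WU U : [set T] U -> bounded_op U.
  by move=> ->; exact: contraction_bounded_op.
have Wq : commutant (commutant [set T]) q.
  apply: commutant_lin => //; last exact: commutant_id.
  by apply: commutant_lin => //; last exact: commutant_comp.
have hq x y : rdot (q x) y = rdot x (q y).
  rewrite !qE !(rdotDl, rdotDr, rdotNl, rdotNr, rdotZl, rdotZr) !ht.
  by [].
have q2 x : q (q x) = q x.
  have tqE : t (q x) = (2^-1 : R)%:C *: (t (t x) + t x).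
    rewrite qE lt (linB lt) t3; apply: rdot_ext => z.
    by rewrite !(rdotDl, rdotNl, rdotZl); field.
  rewrite [in LHS]qE tqE (linZ _ lt) (linD lt) t3 qE; apply: rdot_ext => z.
  by rewrite !(rdotDl, rdotNl, rdotZl); field.
exists q; split=> // x; first by rewrite -TtqE.
have := Tt (x - q x); rewrite Tt1q rdotNl; lra.
Qed.

End SignProjection.

Lemma dependent_choice_nat (X : Type) (P : nat -> X -> Prop) (Q : X -> X -> Prop) x0 :
  P 0 x0 -> (forall n x, P n x -> exists2 y, P n.+1 y & Q x y) ->
  exists f : nat -> X, forall n, P n (f n) /\ Q (f n) (f n.+1).
Proof.
move=> P0 PS.
have /choice[h hP] (z : nat * X) : exists y, P z.1 z.2 -> P z.1.+1 y /\ Q z.2 y.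
  have [/PS[y]|nP] := pselect (P z.1 z.2); first by exists y.
  (* [x0] is a default value for pairs violating the invariant; the sequence [f] never meets one. *)
  by exists x0 => /nP.
pose f := fix f n := if n is m.+1 then h (m, f m) else x0.
have Pf n : P n (f n) by elim: n => //= n /(hP (n, f n))[].
by exists f => n; split=> //; exact: (hP (n, f n) (Pf n)).2.
Qed.

(** * Halving projections in an algebra without eigenprojections *)

Section Diffuse.
Context {R : realType} {H : hilbertType R}.
Variable a : H -> H.
Hypothesis la : linear a.
Hypothesis ha : forall x y, rdot (a x) y = rdot x (a y).
Hypothesis ca : forall x, hnorm (a x) <= 2^-1 * hnorm x.
Implicit Types (x y : H) (e p q : H -> H).

(** These are the projections of {a}''. That algebra contains a and is commutative ([W_comm]), so
    products, orthogonal sums and nested differences of them are again such projections. *)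
Definition spectral_proj e := [/\ commutant (commutant [set a]) e,
  forall x y, rdot (e x) y = rdot x (e y) & forall x, e (e x) = e x].

Let ba : bounded_op a.
Proof. exact: linear_bounded_op la ca. Qed.

Let W_lin (c : R[i]) p q : commutant (commutant [set a]) p ->
  commutant (commutant [set a]) q -> commutant (commutant [set a]) ((c \*: p) \+ q).
Proof. by apply: commutant_lin => U; exact: commutant_bounded. Qed.

Let Wa : commutant (commutant [set a]) a.
Proof. by apply: sub_bicommutant => // U ->. Qed.

Let W_comm p q : commutant (commutant [set a]) p -> commutant (commutant [set a]) q ->
  forall x, p (q x) = q (p x).
Proof.
move=> /commutantP[_ hp] Wq; apply: hp; apply/commutantP; split.
  exact: commutant_bounded Wq.
move=> _ -> x; have /commutantP[_ ->] // := Wq.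
by apply/commutantP; split=> // _ ->.
Qed.

Lemma spectral_proj_comm p q : spectral_proj p -> spectral_proj q ->
  forall x, p (q x) = q (p x).
Proof. by move=> [Wp _ _] [Wq _ _]; exact: W_comm. Qed.

Lemma spectral_proj_linear p : spectral_proj p -> linear p.
Proof. by move=> [/commutant_bounded[]]. Qed.

Lemma spectral_projC p : spectral_proj p -> forall x, a (p x) = p (a x).
Proof. by move=> [Wp _ _] x; exact: W_comm Wa Wp x. Qed.

Lemma spectral_projxx p x : spectral_proj p -> rdot (p x) x = rdot (p x) (p x).
Proof. by move=> [_ hp pp]; rewrite -hp pp. Qed.

Lemma spectral_proj_id : spectral_proj idfun.
Proof. by split=> //; exact: commutant_id. Qed.

Lemma spectral_projM p q : spectral_proj p -> spectral_proj q -> spectral_proj (p \o q).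
Proof.
move=> Pp Pq; have pq := spectral_proj_comm Pp Pq.
case: Pp Pq => [Wp hp pp] [Wq hq qq]; split; first exact: commutant_comp.
  by move=> x y /=; rewrite hp hq pq.
by move=> x /=; rewrite -pq pp qq.
Qed.

Lemma spectral_projB p q : spectral_proj p -> spectral_proj q ->
  (forall x, p (q x) = q x) -> spectral_proj (p \- q).
Proof.
move=> Pp Pq pq; have qp x : q (p x) = q x by rewrite -(spectral_proj_comm Pp Pq).
have lp := spectral_proj_linear Pp; have lq := spectral_proj_linear Pq.
case: Pp Pq => [Wp hp pp] [Wq hq qq]; split.
- have -> : p \- q = ((-1) \*: q) \+ p.
    by apply/funext => x /=; rewrite scaleN1r addrC.
  exact: W_lin.
- by move=> x y /=; rewrite rdotBl rdotBr hp hq.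
by move=> x /=; rewrite (linB lp) (linB lq) pp qq pq qp subrr subr0.
Qed.

Lemma spectral_projD p q : spectral_proj p -> spectral_proj q ->
  (forall x, p (q x) = 0) -> spectral_proj (p \+ q).
Proof.
move=> Pp Pq pq; have qp x : q (p x) = 0 by rewrite -(spectral_proj_comm Pp Pq).
have lp := spectral_proj_linear Pp; have lq := spectral_proj_linear Pq.
case: Pp Pq => [Wp hp pp] [Wq hq qq]; split.
- have -> : p \+ q = (1 \*: p) \+ q by apply/funext => x /=; rewrite scale1r.
  exact: W_lin.
- by move=> x y /=; rewrite rdotDl rdotDr hp hq.
by move=> x /=; rewrite (linD lp) (linD lq) pp qq pq qp addr0 add0r.
Qed.

(** For m <= n, |E_n x - E_m x|^2 = <E_m x, x> - <E_n x, x>, so [strong_limit] applies with g n x =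
    - <E_n x, x>, which is bounded above by 0. *)
Lemma spectral_proj_lim (E : nat -> H -> H) : (forall n, spectral_proj (E n)) ->
  (forall n x, E n (E n.+1 x) = E n.+1 x) ->
  exists e, [/\ spectral_proj e, forall n x, E n (e x) = e x &
    forall x, E n x @[n --> \oo] --> e x].
Proof.
move=> PE Edec.
have lE n := spectral_proj_linear (PE n).
have EE m n x : (m <= n)%N -> E m (E n x) = E n x.
  elim: n x => [|n IH] x; first by rewrite leqn0 => /eqP ->; case: (PE 0).
  rewrite leq_eqVlt => /orP[/eqP ->|mn]; first by case: (PE n.+1).
  by rewrite -Edec IH.
have cE n x : hnorm (E n x) <= hnorm x.
  rewrite -ler_sqr ?nnegrE ?hnorm_ge0 // !hnorm_sqr -subr_ge0.
  have -> : rdot x x - rdot (E n x) (E n x) = rdot (x - E n x) (x - E n x).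
    rewrite !rdotBl !rdotBr (rdotC x) (spectral_projxx x (PE n)); ring.
  exact: rdot_ge0.
have EB x m n : (m <= n)%N -> rdot (E n x - E m x) (E n x - E m x) <=
    - rdot (E n x) x - - rdot (E m x) x.
  move=> mn; rewrite !rdotBl !rdotBr !(spectral_projxx _ (PE _)).
  have e1 : rdot (E m x) (E n x) = rdot (E n x) (E n x).
    case: (PE m) => _ hE _; rewrite hE EE // -(spectral_projxx _ (PE n)).
    by rewrite rdotC.
  rewrite (rdotC (E n x) (E m x)) e1; lra.
have [|e [be ce Ee]] := strong_limit lE cE EB.
  move=> x; exists 0 => n; rewrite oppr_le0 (spectral_projxx _ (PE n)).
  exact: rdot_ge0.
have Ene n x : E n (e x) = e x.
  have bE : bounded_op (E n) by case: (PE n) => /commutant_bounded.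
  have Emx : E (m + n)%N x @[m --> \oo] --> e x.
    by have := Ee x; rewrite -(cvg_shiftn n (E ^~ x)).
  apply: hcvg_uniq (bounded_op_cvg bE Emx) _.
  by under eq_fun => m do rewrite EE ?leq_addl //.
have eC x y : rdot (e x) y = rdot x (e y).
  have e1 : rdot (E n x) y @[n --> \oo] --> rdot (e x) y.
    exact: cvg_rdot (Ee x) (cvg_cst y).
  apply: rcvg_uniq e1 _.
  have hE n : rdot (E n x) y = rdot x (E n y) by case: (PE n).
  under eq_fun => n do rewrite hE.
  exact: cvg_rdot (cvg_cst x) (Ee y).
exists e; split=> //; split.
- by apply: (@commutant_cvg _ _ _ E) => // [U|n]; [exact: commutant_bounded|case: (PE n)].
- by [].
move=> x; apply: hcvg_uniq (Ee (e x)) _; under eq_fun => n do rewrite Ene.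
  exact: cvg_cst.
Qed.

(** By the parallelogram law the common bound is the average of the two left-hand sides. *)
Lemma balance_signs (xs : seq H) (f g : H -> R) :
  \sum_(x <- xs) (f x + g x) ^+ 2 <= \sum_(x <- xs) f x ^+ 2 + \sum_(x <- xs) g x ^+ 2 \/
  \sum_(x <- xs) (f x - g x) ^+ 2 <= \sum_(x <- xs) f x ^+ 2 + \sum_(x <- xs) g x ^+ 2.
Proof.
have : \sum_(x <- xs) (f x + g x) ^+ 2 + \sum_(x <- xs) (f x - g x) ^+ 2 =
  (\sum_(x <- xs) f x ^+ 2 + \sum_(x <- xs) g x ^+ 2) *+ 2.
  rewrite -big_split -big_split /= -sumrMnl; apply: eq_bigr => x _; ring.
move=> h; have [|h2] := lerP (\sum_(x <- xs) (f x + g x) ^+ 2)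
    (\sum_(x <- xs) f x ^+ 2 + \sum_(x <- xs) g x ^+ 2); first by left.
by right; move: h h2; lra.
Qed.

(** The allowed error is proportional to the mass of [e] on the test vectors. This makes the
    property additive over orthogonal projections ([almost_halvableD]) and automatic for small mass
    ([not_halvable_gt]). *)
Definition almost_halvable (xs : seq H) (eps : R) e := exists q, [/\ spectral_proj q,
  forall x, e (q x) = q x &
  \sum_(x <- xs) (rdot (q x) x *+ 2 - rdot (e x) x) ^+ 2 <=
    eps * \sum_(x <- xs) rdot (e x) x].

Lemma almost_halvableD xs eps e1 e2 : spectral_proj e1 -> spectral_proj e2 ->
  (forall x, e1 (e2 x) = 0) -> almost_halvable xs eps e1 -> almost_halvable xs eps e2 ->
  almost_halvable xs eps (e1 \+ e2).
Proof.
move=> P1 P2 e12 [q1 [Q1 eq1 h1]] [q2 [Q2 eq2 h2]].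
have l1 := spectral_proj_linear P1; have l2 := spectral_proj_linear P2.
have e21 x : e2 (e1 x) = 0 by rewrite -(spectral_proj_comm P1 P2).
have hs : \sum_(x <- xs) rdot (e1 x + e2 x) x =
   \sum_(x <- xs) rdot (e1 x) x + \sum_(x <- xs) rdot (e2 x) x.
  by rewrite -big_split; apply: eq_bigr => x _; rewrite rdotDl.
(* [q3] will be [q2] or [e2 \- q2], whose errors 2 q3 - e2 differ only in sign; [balance_signs]
   tells for which of them the cross terms are harmless. *)
have glue q3 : spectral_proj q3 -> (forall x, e2 (q3 x) = q3 x) ->
   \sum_(x <- xs) (rdot (q1 x) x *+ 2 - rdot (e1 x) x +
      (rdot (q3 x) x *+ 2 - rdot (e2 x) x)) ^+ 2 <=
   \sum_(x <- xs) (rdot (q1 x) x *+ 2 - rdot (e1 x) x) ^+ 2 +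
   \sum_(x <- xs) (rdot (q2 x) x *+ 2 - rdot (e2 x) x) ^+ 2 ->
   almost_halvable xs eps (e1 \+ e2).
  move=> Q3 eq3 h3; exists (q1 \+ q3); split.
  - apply: spectral_projD => // x.
    rewrite -eq3 (spectral_proj_comm Q1 P2) -eq1 e21 //.
  - move=> x /=; rewrite (linD l1) (linD l2) eq1 eq3.
    have -> : e1 (q3 x) = 0 by rewrite -eq3 e12.
    have -> : e2 (q1 x) = 0 by rewrite -eq1 e21.
    by rewrite addr0 add0r.
  rewrite /= hs mulrDr; apply: le_trans (lerD h1 h2); apply: le_trans h3.
  rewrite le_eqVlt; apply/orP; left; apply/eqP/eq_bigr => x _.
  by rewrite !rdotDl; congr (_ ^+ 2); ring.
have [h|h] := balance_signs xs (fun x => rdot (q1 x) x *+ 2 - rdot (e1 x) x)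
  (fun x => rdot (q2 x) x *+ 2 - rdot (e2 x) x); first exact: glue h.
apply: (glue (e2 \- q2)); first exact: spectral_projB.
  by move=> x /=; rewrite (linB l2) eq2; case: P2 => _ _ ->.
apply: le_trans h; rewrite le_eqVlt; apply/orP; left; apply/eqP/eq_bigr => x _.
by rewrite /= rdotBl; congr (_ ^+ 2); ring.
Qed.

(** If the mass is at most eps, then q = e is good enough: with r = <e x, x>, the error is sum r^2
    <= (sum r)^2 <= eps sum r. *)
Lemma not_halvable_gt xs eps e : spectral_proj e -> ~ almost_halvable xs eps e ->
  eps < \sum_(x <- xs) rdot (e x) x.
Proof.
move=> Pe; rewrite ltNge => nh; apply/negP => le; apply: nh.
exists e; split=> // [x|]; first by case: Pe.
have e0 x : 0 <= rdot (e x) x by rewrite spectral_projxx ?rdot_ge0.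
apply: (@le_trans _ _ ((\sum_(x <- xs) rdot (e x) x) ^+ 2)); last first.
  by rewrite expr2 ler_wpM2r // sumr_ge0.
elim: xs {le} => [|x xs IH]; first by rewrite !big_nil expr0n.
rewrite !big_cons; set S := \sum_(j <- xs) rdot _ _ in IH *.
have S0 : 0 <= S by rewrite sumr_ge0.
have -> : (rdot (e x) x *+ 2 - rdot (e x) x) ^+ 2 = rdot (e x) x ^+ 2 by ring.
have := e0 x; set r := rdot _ _ => r0.
apply: le_trans (lerD (lexx _) IH) _.
have := mulr_ge0 r0 S0; nra.
Qed.

(** The bounds 1/2 on a and m make a - m a contraction, so [sign_projection] applies to it; a and a
    - m have the same commutant. *)
Lemma spectral_split (m : R) : `|m| <= 2^-1 -> exists q, [/\ spectral_proj q,
  forall x, m * rdot (q x) (q x) <= rdot (a (q x)) (q x) &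
  forall x, rdot (a (x - q x)) (x - q x) <= m * rdot (x - q x) (x - q x)].
Proof.
move=> mle; pose T := ((- m)%:C \*: idfun) \+ a.
have TE x : T x = - (m%:C *: x) + a x by rewrite /T /= rmorphN scaleNr.
have bT : bounded_op T by exact: bounded_op_lin bounded_op_id ba.
have hT x y : rdot (T x) y = rdot x (T y).
  by rewrite !TE rdotDl rdotDr rdotNl rdotNr rdotZl rdotZr ha.
have cT x : hnorm (T x) <= hnorm x.
  rewrite TE; apply: le_trans (ler_hnormD _ _) _.
  have hm : hnorm (m%:C *: x) = `|m| * hnorm x.
    by apply: complexI; rewrite hnormZ rmorphM /= normc_def /= expr0n addr0 sqrtr_sqr.
  rewrite hnorm_opp hm; have := ca x; have := ler_wpM2r (hnorm_ge0 x) mle; lra.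
have [q [Wq hq qq q1 q2]] := sign_projection bT.1 hT cT.
exists q; split.
- split=> //; apply: commutantS Wq => S /commutantP[bS Sa]; apply/commutantP.
  by split=> // _ -> x; rewrite !TE (linD bS.1) (linN bS.1) (linZ _ bS.1) Sa.
- by move=> x; have := q1 x; rewrite TE rdotDl rdotNl rdotZl; lra.
by move=> x; have := q2 x; move: (x - q x) => y; rewrite TE rdotDl rdotNl rdotZl; lra.
Qed.

Hypothesis diffuse : forall e (l : R), spectral_proj e ->
  (forall x, a (e x) = l%:C *: e x) -> forall x, e x = 0.

Lemma diffuse_almost_halvable xs eps e : 0 < eps -> spectral_proj e ->
  almost_halvable xs eps e.
Proof.
move=> eps0 Pe; apply: contrapT => nh.
(* At stage n the form of a on the range of [s.1] lies between [s.2] and [s.2] + 2^-n, an interval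
   inside [-1/2, 1/2], and [s.1] is not halvable. *)
pose P n (s : (H -> H) * R) := [/\ spectral_proj s.1, - 2^-1 <= s.2,
  s.2 + 2^-1 ^+ n <= 2^-1, forall x, s.2 * rdot (s.1 x) (s.1 x) <=
     rdot (a (s.1 x)) (s.1 x) <= (s.2 + 2^-1 ^+ n) * rdot (s.1 x) (s.1 x) &
  ~ almost_halvable xs eps s.1].
have P0 : P 0 (e, - 2^-1).
  split=> //=; first by rewrite expr0; lra.
  move=> x; have := rdot_CS (a (e x)) (e x); rewrite ler_norml => /andP[h1 h2].
  have := ler_wpM2r (hnorm_ge0 (e x)) (ca (e x)).
  rewrite -mulrA -expr2 hnorm_sqr expr0 => h3; apply/andP; split; lra.
have PS n s : P n s -> exists2 s', P n.+1 s' & forall x, s.1 (s'.1 x) = s'.1 x.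
  case: s => [f l] [/= Pf l1 l2 fl nf].
  have c0 : 0 < 2^-1 ^+ n.+1 :> R by rewrite exprn_gt0.
  have c2 : 2^-1 ^+ n = 2^-1 ^+ n.+1 + 2^-1 ^+ n.+1 :> R by rewrite exprS; field.
  (* The interval is cut at its midpoint. If the upper part f q is halvable, the lower part f - f q
     is not, by [almost_halvableD]. *)
  have [|q [Pq q1 q2]] := @spectral_split (l + 2^-1 ^+ n.+1).
    by rewrite ler_norml; apply/andP; split; lra.
  have Pfq := spectral_projM Pf Pq.
  have lf := spectral_proj_linear Pf; have ff : forall x, f (f x) = f x by case: Pf.
  have fq := spectral_proj_comm Pf Pq.
  have Pfq' : spectral_proj (f \- (f \o q)) by apply: spectral_projB => // x /=.
  have [h1|h1] := pselect (almost_halvable xs eps (f \o q)); last first.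
    exists (f \o q, l + 2^-1 ^+ n.+1) => //=; split=> //=; try lra.
    move=> x; rewrite fq q1 /=; have /andP[_] := fl (q x).
    rewrite !fq c2; lra.
  exists (f \- (f \o q), l) => //=; last by move=> x; rewrite (linB lf) !ff.
  split=> //=; try lra.
    move=> x; have := q2 (f x); rewrite -fq => ->; rewrite andbT.
    have /andP[+ _] := fl (x - q x); by rewrite (linB lf).
  move=> h2; apply: nf; have -> : f = (f \o q) \+ (f \- (f \o q)).
    by apply/funext => x /=; rewrite addrC subrK.
  apply: almost_halvableD => // x /=.
  have lq := spectral_proj_linear Pq; have [_ _ qq] := Pq.
  by rewrite fq (linB lf) !ff (linB lq) -!fq qq subrr.
have [s sP] := dependent_choice_nat P0 PS.
have [||f [Pf sf lims]] := @spectral_proj_lim (fun n => (s n).1).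
- by move=> n; have [[]] := sP n.
- by move=> n x; have [_ ->] := sP n.
have lim_sum : \sum_(x <- xs) rdot ((s n).1 x) x @[n --> \oo] -->
    \sum_(x <- xs) rdot (f x) x.
  elim: (xs) => [|x ys IH].
    by under eq_fun => n do rewrite big_nil; rewrite big_nil; exact: cvg_cst.
  under eq_fun => n do rewrite big_cons; rewrite big_cons.
  by apply: cvgD IH; exact: cvg_rdot (lims x) (cvg_cst x).
(* Every stage has mass greater than eps, so the limit f keeps mass at least eps and is nonzero. *)
have sum_ge : eps <= \sum_(x <- xs) rdot (f x) x.
  apply: ler_cvg_to (cvg_cst _) lim_sum _; apply: nearW => n.
  by have [[Ps _ _ _ ns] _] := sP n; exact/ltW/not_halvable_gt.
have [f0|/existsNP[y fy0]] := pselect (forall x, f x = 0).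
  move: sum_ge; rewrite big1 => [|x _]; last by rewrite f0 rdot0l.
  by rewrite leNgt eps0.
have ff x : f (f x) = f x by case: Pf.
have fy_gt0 : 0 < rdot (f y) (f y).
  by rewrite lt_neqAle rdot_ge0 andbT eq_sym; apply/eqP => /rdot_eq0.
(* The Rayleigh quotient of a at f y lies in the intervals of all stages, whose lengths tend to 0,
   so it is their only common point. *)
pose l := rdot (a (f y)) (f y) / rdot (f y) (f y).
have quad x : rdot (a (f x)) (f x) = l * rdot (f x) (f x).
  have bnd n z : (s n).2 * rdot (f z) (f z) <= rdot (a (f z)) (f z) <=
      ((s n).2 + 2^-1 ^+ n) * rdot (f z) (f z).
    by have [[_ _ _ + _] _] := sP n => /(_ (f z)); rewrite !sf.
  have lE : rdot (a (f y)) (f y) = l * rdot (f y) (f y).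
    by rewrite /l divfK // gt_eqF.
  have lb n : (s n).2 <= l <= (s n).2 + 2^-1 ^+ n.
    by have := bnd n y; rewrite lE !ler_pM2r.
  have d n : `|rdot (a (f x)) (f x) - l * rdot (f x) (f x)| <=
      2^-1 ^+ n * rdot (f x) (f x).
    have /andP[b1 b2] := bnd n x; have /andP[b3 b4] := lb n.
    have := ler_wpM2r (rdot_ge0 (f x)) b3; have := ler_wpM2r (rdot_ge0 (f x)) b4.
    rewrite ler_norml => h1 h2; apply/andP; split; lra.
  have cv : (2^-1 : R) ^+ n * rdot (f x) (f x) @[n --> \oo] --> (0 : R).
    rewrite -[X in _ --> X](mul0r (rdot (f x) (f x))); apply: cvgMr_tmp.
    by apply: cvg_expr; rewrite ger0_norm ?invr_ge0 // invf_lt1 ?ltr1n.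
  apply/eqP; rewrite -subr_eq0 -normr_le0.
  by apply: ler_cvg_to (cvg_cst _) cv _; exact: nearW.
apply: fy0; apply: (diffuse Pf (l := l)) => x; apply: rdot_ext => z.
have [_ hf _] := Pf; have lf := spectral_proj_linear Pf.
have fz w : rdot w (f z) = rdot (f w) z by rewrite hf.
(* Polarizing [quad] at x + z gives <a f x, f z> = l <f x, f z>. *)
have := quad (x + z); rewrite (linD lf) (linD la) !rdotDl !rdotDr !quad.
have -> : rdot (a (f z)) (f x) = rdot (a (f x)) (f z) by rewrite ha rdotC.
rewrite (rdotC (f z) (f x)) rdotZl.
have -> : rdot (a (f x)) z = rdot (a (f x)) (f z).
  by rewrite fz -(spectral_projC Pf) ff.
have -> : rdot (f x) z = rdot (f x) (f z) by rewrite fz ff.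
lra.
Qed.

End Diffuse.

Lemma normc_nneg (R : realType) (z : R[i]) : 0 <= normc z.
Proof. by case: z => a b; exact: sqrtr_ge0. Qed.

(** * Orthonormal sequences and partial isometries *)

Section OrthonormalSequences.
Context {R : realType} {K : hilbertType R}.
Implicit Types (x y : K) (e f : nat -> K).

(** The imaginary part of <x, y> is the real part of <x, i y>, and S commutes with i. *)
Lemma adjoint_rdot (T S : K -> K) : linear S ->
  (forall x y, rdot (T x) y = rdot x (S y)) -> adjoint T S.
Proof. by move=> lS TS x y; rewrite !inner_rdot !TS (linZ _ lS). Qed.

Lemma rdot_adjoint (T S : K -> K) : adjoint T S -> forall x y, rdot (T x) y = rdot x (S y).
Proof. by move=> TS x y; rewrite /rdot TS. Qed.

Lemma adjointC (T S : K -> K) : adjoint T S -> adjoint S T.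
Proof. by move=> TS x y; rewrite innerC -TS -innerC. Qed.

Definition orthonormal_seq e := forall i j, inner (e i) (e j) = (i == j)%:R.

Lemma inner_suml (n m : nat) (F : nat -> K) y :
  inner (\sum_(m <= k < n) F k) y = \sum_(m <= k < n) inner (F k) y.
Proof. exact: linear_sumlz. Qed.

Lemma inner_sumr (n m : nat) (F : nat -> K) y :
  inner y (\sum_(m <= k < n) F k) = \sum_(m <= k < n) inner y (F k).
Proof. exact: linear_sumr. Qed.

Lemma orthonormal_sum e m n (c : nat -> R[i]) : orthonormal_seq e ->
  rdot (\sum_(m <= k < n) c k *: e k) (\sum_(m <= k < n) c k *: e k) =
  \sum_(m <= k < n) normc (c k) ^+ 2.
Proof.
move=> oe; apply: complexI; rewrite rdotxx inner_suml rmorph_sum /=.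
apply: eq_big_nat => k kmn; rewrite innerZl inner_sumr (bigD1_seq k) /=; last 2 first.
- by rewrite mem_index_iota.
- exact: iota_uniq.
rewrite innerZr oe eqxx mulr1 big1 ?addr0; last first.
  by move=> j jk; rewrite innerZr oe eq_sym (negbTE jk) mulr0.
by rewrite -sqr_normc rmorphXn.
Qed.

Lemma bessel e n x : orthonormal_seq e ->
  \sum_(0 <= k < n) normc (inner x (e k)) ^+ 2 <= rdot x x.
Proof.
move=> oe; set y := \sum_(0 <= k < n) inner x (e k) *: e k.
have xy : rdot x y = \sum_(0 <= k < n) normc (inner x (e k)) ^+ 2.
  rewrite /rdot inner_sumr raddf_sum; apply: eq_bigr => k _.
  by rewrite innerZr mulrC -sqr_normc -rmorphXn.
have := rdot_ge0 (x - y); rewrite !rdotBl !rdotBr (rdotC y x) xy orthonormal_sum //; lra.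
Qed.

(** Bessel's inequality bounds the squared norms of the partial sums, which serve as [g] in
    [strong_limit]. Exchanging [e] and [f] produces the adjoint. *)
Lemma partial_isometry e f : orthonormal_seq e -> orthonormal_seq f ->
  exists2 U, bounded_op U &
  forall x, \sum_(0 <= k < n) inner x (e k) *: f k @[n --> \oo] --> U x.
Proof.
move=> oe of_.
have [||||U [bU _ lim]] := @strong_limit _ K
    (fun n x => \sum_(0 <= k < n) inner x (e k) *: f k)
    (fun n x => \sum_(0 <= k < n) normc (inner x (e k)) ^+ 2).
- move=> n a x y; rewrite scaler_sumr -big_split /=; apply: eq_bigr => k _.
  by rewrite innerDl innerZl scalerDl scalerA.
- move=> n x; rewrite -ler_sqr ?nnegrE ?hnorm_ge0 // !hnorm_sqr orthonormal_sum //.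
  exact: bessel.
- move=> x m n mn.
  rewrite (big_cat_nat (n := m)) //= [X in _ <= X - _](big_cat_nat (n := m)) //=.
  by rewrite !(addrC (\sum_(0 <= k < m) _)) !addrK orthonormal_sum.
- by move=> x; exists (rdot x x) => n; exact: bessel.
by exists U.
Qed.

Lemma partial_isometryE e f U : orthonormal_seq e ->
  (forall x, \sum_(0 <= k < n) inner x (e k) *: f k @[n --> \oo] --> U x) ->
  forall k, U (e k) = f k.
Proof.
move=> oe lim k; apply: hcvg_uniq (lim _) _.
apply: cvg_near_cst; near=> n; rewrite (bigD1_seq k) /= ?iota_uniq //; last first.
  by rewrite mem_index_iota /=; near: n; exact: nbhs_infty_gt.
rewrite oe eqxx scale1r big1 ?addr0 // => j jk.
by rewrite oe eq_sym (negbTE jk) scale0r.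
Unshelve. all: by end_near. Qed.

Lemma partial_isometry_adjoint e f U V : bounded_op V ->
  (forall x, \sum_(0 <= k < n) inner x (e k) *: f k @[n --> \oo] --> U x) ->
  (forall x, \sum_(0 <= k < n) inner x (f k) *: e k @[n --> \oo] --> V x) ->
  adjoint U V.
Proof.
move=> bV limU limV; apply: adjoint_rdot; first exact: bV.1.
move=> x y.
have e1 : rdot (\sum_(0 <= k < n) inner x (e k) *: f k) y @[n --> \oo] --> rdot (U x) y.
  exact: cvg_rdot (limU x) (cvg_cst y).
apply: rcvg_uniq e1 _.
have E n : rdot (\sum_(0 <= k < n) inner x (e k) *: f k) y =
    rdot x (\sum_(0 <= k < n) inner y (f k) *: e k).
  rewrite /rdot inner_suml inner_sumr; congr complex.Re; apply: eq_bigr => k _.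
  by rewrite innerZl innerZr -innerC mulrC.
under eq_fun => n do rewrite E.
exact: cvg_rdot (cvg_cst x) (limV y).
Qed.

End OrthonormalSequences.

(** * The bilateral shift on l^2(Z) *)

Section BilateralShift.
Context {R : realType} {K : hilbertType R}.
Variable delta : int -> K.
Hypothesis basis : orthonormal_basis delta.
Implicit Types (x y : K).

Let enum_int (k : nat) : int := if odd k then Negz k./2 else Posz k./2.

Let enum_int_inj : injective enum_int.
Proof.
move=> i j; rewrite /enum_int => h.
rewrite -(odd_double_half i) -(odd_double_half j); move: h.
by case: (odd i) (odd j) => -[] //= [->].
Qed.

Let enum_int_surj z : exists k, enum_int k = z.
Proof.
case: z => n; [exists n.*2|exists n.*2.+1]; rewrite /enum_int /= odd_double /=.
  by rewrite doubleK.
by rewrite uphalf_double.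
Qed.

Lemma shift_exists : exists U V, [/\ bounded_op U, bounded_op V, adjoint U V,
  forall h, U (delta h) = delta (1 + h) & forall h, V (delta h) = delta (-1 + h)].
Proof.
have oe : orthonormal_seq (delta \o enum_int).
  by move=> i j /=; rewrite (basis_orthonormal basis) (inj_eq enum_int_inj).
have of_ : orthonormal_seq (fun k => delta (1 + enum_int k)).
  move=> i j /=; rewrite (basis_orthonormal basis) (inj_eq (addrI _)).
  by rewrite (inj_eq enum_int_inj).
have [U bU limU] := partial_isometry oe of_.
have [V bV limV] := partial_isometry of_ oe.
exists U, V; split=> //.
- exact: partial_isometry_adjoint limU limV.
- by move=> h; have [k <-] := enum_int_surj h; exact: (partial_isometryE oe limU k).
- move=> h; have [k hk] := enum_int_surj (-1 + h).
  by have := partial_isometryE of_ limV k; rewrite /= hk addNKr // addKr.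
Qed.

Variables U V : K -> K.
Hypotheses (bU : bounded_op U) (bV : bounded_op V) (UV : adjoint U V).
Hypothesis Udelta : forall h, U (delta h) = delta (1 + h).
Hypothesis Vdelta : forall h, V (delta h) = delta (-1 + h).

Lemma shiftK x : V (U x) = x.
Proof.
apply/eqP; rewrite -subr_eq0; apply/eqP/(basis_total basis) => i.
have e : inner (V (U x)) (delta i) = inner x (delta i).
  by rewrite (adjointC UV) Udelta UV Vdelta addKr.
by rewrite innerBl e subrr.
Qed.

Lemma shift_bessel x n (s : bool) m :
  \sum_(0 <= k < m) normc (inner x (delta (if s then n + k%:Z else n - k%:Z))) ^+ 2 <=
  rdot x x.
Proof.
apply: (@bessel _ _ (fun k : nat => delta (if s then n + k%:Z else n - k%:Z))).
move=> i j; rewrite (basis_orthonormal basis); case: s.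
  by rewrite (inj_eq (addrI _)).
by rewrite (inj_eq (addrI _)) eqr_opp.
Qed.

(** The coefficients of x satisfy x_(h+1) = b x_h, so their moduli do not decrease to the right if
    |b| >= 1, and to the left if |b| < 1. A nonzero coefficient would then force infinitely many to
    stay away from 0, against Bessel's inequality. *)
Lemma shift_no_eigenvalue (b : R[i]) x : V x = b *: x -> x = 0.
Proof.
move=> Vx; apply: (basis_total basis) => n.
have xi h : inner x (delta (1 + h)) = b * inner x (delta h).
  by rewrite -Udelta -(adjointC UV) Vx innerZl.
suff [s hs] : exists s : bool, forall k : nat, normc (inner x (delta n)) <=
    normc (inner x (delta (if s then n + k%:Z else n - k%:Z))).
  apply: eq0_normc; apply/eqP; rewrite -sqrf_eq0 eq_le sqr_ge0 andbT leNgt.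
  apply/negP => t0; set t := normc _ ^+ 2 in t0.
  have B m : m%:R * t <= rdot x x.
    apply: le_trans (shift_bessel x n s m).
    rewrite mulr_natl -[X in _ *+ X]subn0 -sumr_const_nat; apply: ler_sum => k _.
    by rewrite ler_sqr ?nnegrE ?normc_nneg.
  have := archi_boundP (divr_ge0 (rdot_ge0 x) (ltW t0)).
  by rewrite ltr_pdivrMr // ltNge B.
have [b1|b1] := lerP 1 (normc b).
  exists true => /= k; elim: k => [|k IH]; first by rewrite addr0.
  rewrite (_ : n + k.+1 = 1 + (n + k)); last by rewrite intS addrCA.
  by rewrite xi normcM; apply: le_trans IH _; rewrite ler_peMl ?normc_nneg.
exists false => /= k; elim: k => [|k IH]; first by rewrite subr0.
apply: le_trans IH _; rewrite (_ : n - k%:Z = 1 + (n - k.+1%:Z)); last first.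
  by rewrite intS; ring.
by rewrite xi normcM ler_piMl ?normc_nneg // ltW.
Qed.

(** Applying V and using V U = 1 gives V^2 x - l V x + x = 0. The polynomial has the complex roots
    l/2 + s and l/2 - s with s^2 = (l/2)^2 - 1, and V minus either root is injective. *)
Lemma shift_sum_no_eigenvalue (l : R) x : U x + V x = l%:C *: x -> x = 0.
Proof.
move=> eq; pose s := sqrtc ((l / 2) ^+ 2 - 1)%:C.
have s2 : s ^+ 2 = (l%:C / 2) ^+ 2 - 1.
  by rewrite sqr_sqrtc rmorphB rmorphXn rmorph1 fmorph_div rmorph_nat.
apply: (@shift_no_eigenvalue (l%:C / 2 + s)).
apply/eqP; rewrite -subr_eq0; apply/eqP.
apply: (@shift_no_eigenvalue (l%:C / 2 - s)).
have VV : V (V x) = l%:C *: V x - x.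
  by rewrite -(linZ _ bV.1) -eq (linD bV.1) shiftK addrC addKr.
rewrite (linB bV.1) (linZ _ bV.1) VV scalerBr scalerA.
have -> : (l%:C / 2 - s) * (l%:C / 2 + s) = 1.
  by rewrite -subr_sqr s2 opprB addrC subrK.
rewrite scale1r addrAC -scalerBl; congr (_ *: _ - _).
by rewrite opprD addrA; congr (_ - _); field.
Qed.

End BilateralShift.

(** * Closure properties of von Neumann algebras *)

Section VonNeumann.
Context {R : realType} {H : hilbertType R}.
Implicit Types (M A : set (H -> H)) (S T : H -> H) (c : R[i]).

Lemma vN_bounded M T : von_neumann M -> M T -> bounded_op T.
Proof. by move=> [_ <-] /commutant_bounded. Qed.

Lemma vN_id M : von_neumann M -> M idfun.
Proof. by move=> [_ <-]; exact: commutant_id. Qed.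

Lemma vN_comp M S T : von_neumann M -> M S -> M T -> M (S \o T).
Proof. by move=> [_ <-]; exact: commutant_comp. Qed.

Lemma vN_lin M c S T : von_neumann M -> M S -> M T -> M ((c \*: S) \+ T).
Proof. by move=> [_ <-]; apply: commutant_lin => U; exact: commutant_bounded. Qed.

Lemma vN_D M S T : von_neumann M -> M S -> M T -> M (S \+ T).
Proof.
move=> vM MS MT; have := vN_lin 1 vM MS MT; congr (M _).
by apply/funext => x /=; rewrite scale1r.
Qed.

Lemma vN_Z M c T : von_neumann M -> M T -> M (c \*: T).
Proof.
move=> vM MT; have := vN_lin (c - 1) vM MT MT; congr (M _).
by apply/funext => x /=; rewrite scalerBl scale1r subrK.
Qed.

Lemma vN_bicommutant M a : von_neumann M -> M a ->
  commutant (commutant [set a]) `<=` M.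
Proof.
by move=> [_ MM] Ma; rewrite -[X in _ `<=` X]MM; do 2!apply: commutantS => //; move=> _ ->.
Qed.

Lemma vN_cvg M (s : nat -> H -> H) T : von_neumann M -> bounded_op T ->
  (forall n, M (s n)) -> (forall x, s n x @[n --> \oo] --> T x) -> M T.
Proof.
move=> [_ <-] bT Ms; apply: commutant_cvg => // U; exact: commutant_bounded.
Qed.

Lemma sub_generated_vN A : A `<=` generated_vN A.
Proof. by move=> T AT M [_]; exact. Qed.

Lemma generated_vN_id A : generated_vN A idfun.
Proof. by move=> M [vM _]; exact: vN_id. Qed.

Lemma generated_vN_comp A S T :
  generated_vN A S -> generated_vN A T -> generated_vN A (S \o T).
Proof. by move=> hS hT M hM; case: (hM) => vM _; exact: vN_comp (hS _ hM) (hT _ hM). Qed.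

Lemma generated_vN_D A S T :
  generated_vN A S -> generated_vN A T -> generated_vN A (S \+ T).
Proof. by move=> hS hT M hM; case: (hM) => vM _; exact: vN_D (hS _ hM) (hT _ hM). Qed.

Lemma generated_vN_Z A c T : generated_vN A T -> generated_vN A (c \*: T).
Proof. by move=> hT M hM; case: (hM) => vM _; exact: vN_Z (hT _ hM). Qed.

End VonNeumann.

(** The operator is a = phi(U + V)/4. An e in N with a e = l e pulls back to e0 with (U + V) e0 = 4
    l e0, so e0 maps every vector to a solution of the eigenvalue equation of U + V, that is, to
    0. *)
Lemma group_vN_diffuse (R : realType) (K H : hilbertType R) (delta : int -> K)
    (N : set (H -> H)) (phi : (K -> K) -> (H -> H)) :
  orthonormal_basis delta -> von_neumann N -> star_isomorphism (group_vN delta) N phi ->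
  exists a : H -> H, [/\ N a, forall x y, rdot (a x) y = rdot x (a y),
    forall x, hnorm (a x) <= 2^-1 * hnorm x &
    forall e (l : R), N e -> (forall x, a (e x) = l%:C *: e x) -> forall x, e x = 0].
Proof.
move=> bd vN iso.
have [U [V [bU bV UV Ud Vd]]] := shift_exists bd.
have LU : group_vN delta U by apply: sub_generated_vN; split=> //; exists 1.
have LV : group_vN delta V by apply: sub_generated_vN; split=> //; exists (-1).
have [phiN phiI phiS] := star_iso_bij iso.
have Nphi T : group_vN delta T -> N (phi T) by move=> LT; exact: phiN.
pose c : R[i] := (4^-1 : R)%:C.
have LcU : group_vN delta (c \*: U) by exact: generated_vN_Z.
have LcV : group_vN delta (c \*: V) by exact: generated_vN_Z.
(* N contains the identity, which is thus some phi t, and multiplication by phi 1 leaves phi t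
   unchanged. *)
have phi1 : phi idfun = idfun.
  have [t Lt phit] := phiS _ (vN_id vN).
  have : phi t = phi idfun \o phi t.
    have L1 : group_vN delta idfun by exact: generated_vN_id.
    exact: (star_isoM iso L1 Lt).
  by rewrite phit.
have bu := vN_bounded vN (Nphi _ LU); have bv := vN_bounded vN (Nphi _ LV).
have uv := star_iso_adjoint iso LU UV.
have vu x : phi V (phi U x) = x.
  have := congr1 (@^~ x) (star_isoM iso LV LU) => /= <-.
  rewrite (_ : V \o U = idfun) ?phi1 //.
  by apply/funext => y; exact: (shiftK bd UV Ud Vd).
have hu x : hnorm (phi U x) = hnorm x.
  by rewrite /hnorm (rdot_adjoint uv) vu.
(* For u, v the images of U, V: |v x|^2 = <u v x, x> <= |u v x| |x| = |v x| |x|. *)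
have hv x : hnorm (phi V x) <= hnorm x.
  have [h0|h0] := eqVneq (hnorm (phi V x)) 0; first by rewrite h0 hnorm_ge0.
  have h1 : 0 < hnorm (phi V x) by rewrite lt_neqAle hnorm_ge0 eq_sym h0.
  rewrite -(ler_pM2l h1) -expr2 hnorm_sqr -(rdot_adjoint uv).
  by apply: le_trans (ler_norm _) _; rewrite -{1}(hu (phi V x)); exact: rdot_CS.
exists ((c \*: phi U) \+ (c \*: phi V)); split.
- by apply: vN_D => //; apply: vN_Z => //; exact: Nphi.
- move=> x y /=; rewrite rdotDl rdotDr !rdotZl !rdotZr (rdot_adjoint uv).
  by rewrite (rdot_adjoint (adjointC uv)) addrC.
- move=> x /=; apply: le_trans (ler_hnormD _ _) _.
  have hc y : hnorm (c *: y) = 4^-1 * hnorm y.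
    apply: complexI; rewrite hnormZ rmorphM /= normc_def /= expr0n addr0 sqrtr_sqr.
    by rewrite ger0_norm ?invr_ge0.
  by rewrite !hc hu; have := hv x; lra.
move=> e l Ne ae.
have [e0 Le0 phie0] := phiS _ Ne.
have phiA : phi ((c \*: U) \+ (c \*: V)) = (c \*: phi U) \+ (c \*: phi V).
  by rewrite (star_isoD iso) // !(star_isoZ iso).
have LA : group_vN delta ((c \*: U) \+ (c \*: V)) by exact: generated_vN_D.
have eq0 : ((c \*: U) \+ (c \*: V)) \o e0 = l%:C \*: e0.
  apply: phiI; rewrite ?inE; [exact: generated_vN_comp|exact: generated_vN_Z|].
  rewrite (star_isoM iso) // (star_isoZ iso) // phiA phie0.
  by apply/funext => x; exact: ae.
have e00 x : e0 x = 0.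
  apply: (shift_sum_no_eigenvalue bd bV UV Ud Vd (l := 4 * l)).
  have /(congr1 (fun f => (4 : R)%:C *: f x)) := eq0.
  rewrite /= -scalerDr !scalerA -!rmorphM /= mulfV ?pnatr_eq0 // scale1r.
  by move->.
move=> x; have -> : e = 0 \*: phi e0; last by rewrite /= scale0r.
rewrite -(star_isoZ iso) // -phie0; congr (phi _).
by apply/funext => y /=; rewrite scale0r e00.
Qed.

(** * Weak convergence to half a projection *)

Section HalvingSequence.
Context {R : realType} {H : hilbertType R}.
Implicit Types (x y : H) (e q : H -> H) (M : set (H -> H)).

Definition projection e := [/\ linear e, forall x y, rdot (e x) y = rdot x (e y) &
  forall x, e (e x) = e x].

Lemma projectionxx e x : projection e -> rdot (e x) x = rdot (e x) (e x).
Proof. by move=> [_ he ee]; rewrite -he ee. Qed.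

Lemma projection_le e x : projection e -> rdot (e x) (e x) <= rdot x x.
Proof.
move=> pe; rewrite -subr_ge0.
have -> : rdot x x - rdot (e x) (e x) = rdot (x - e x) (x - e x).
  by rewrite !rdotBl !rdotBr (rdotC x) (projectionxx x pe); ring.
exact: rdot_ge0.
Qed.

(** For q <= e one has (2q - e)^2 = e, so |(2q - e) x| = |e x|. *)
Lemma reflection_contraction e q x : projection e -> projection q ->
  (forall x, e (q x) = q x) -> hnorm (q x *+ 2 - e x) <= hnorm x.
Proof.
move=> pe pq eq; rewrite -ler_sqr ?nnegrE ?hnorm_ge0 // !hnorm_sqr.
apply: le_trans (projection_le x pe); rewrite mulr2n !rdotBl !rdotBr !rdotDl !rdotDr.
have e1 : rdot (q x) (e x) = rdot (q x) (q x).
  by case: pe => _ he _; rewrite -he eq -(projectionxx x pq).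
by rewrite (rdotC (e x) (q x)) e1; lra.
Qed.

Lemma rdot_polarization (r : H -> H) x y : linear r ->
  (forall x y, rdot (r x) y = rdot x (r y)) ->
  rdot (r x) y = 4^-1 * (rdot (r (x + y)) (x + y) - rdot (r (x - y)) (x - y)).
Proof.
move=> lr hr; rewrite (linD lr) (linB lr) !rdotDl !rdotDr !rdotNl !rdotNr.
by rewrite (hr y x) (rdotC y (r x)); field.
Qed.

Lemma normc_le_rdot x y : normc (inner x y) <= `|rdot x y| + `|rdot x ('i%C *: y)|.
Proof.
rewrite inner_rdot; set a := rdot x y; set b := rdot x _.
have -> : a +i* b = a%:C + 'i%C * b%:C by rewrite [LHS]complexE.
apply: le_trans (le_normcD _ _) _; rewrite normcM /= !expr0n /= add0r expr1n.
by rewrite sqrtr1 mul1r !addr0 !sqrtr_sqr.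
Qed.

Lemma normc_inner_CS x y : normc (inner x y) <= hnorm x * hnorm y.
Proof.
have [->|c0] := eqVneq (inner x y) 0.
  by rewrite normc0 mulr_ge0 // hnorm_ge0.
set c := inner x y in c0 *.
have n0 : 0 < normc c by rewrite -ltcR -[(normc c)%:C]/`|c| normr_gt0.
(* The phase u = c/|c| rotates y so that <x, u y> = |c|, which reduces the claim to the real inner
   product. *)
pose u := c * ((normc c)^-1)%:C.
have uJ : u^*%C = c^*%C * ((normc c)^-1)%:C.
  rewrite /u; move: (normc c)^-1 => t; case: (c) => p s.
  by apply/eqP; rewrite eq_complex /=; apply/andP; split; apply/eqP; ring.
have cJ : c * c^*%C = (normc c ^+ 2)%:C by rewrite -sqr_normc rmorphXn.
have nu : u * u^*%C = 1.
  rewrite uJ /u mulrACA cJ -!rmorphM /= -[1]/((1 : R)%:C); congr (_%:C).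
  by field; rewrite gt_eqF.
have h1 : rdot x (u *: y) = normc c.
  rewrite /rdot innerZr -/c uJ mulrAC (mulrC _ c) cJ -rmorphM /=.
  by field; rewrite gt_eqF.
have h2 : hnorm (u *: y) = hnorm y.
  by rewrite /hnorm /rdot innerZl innerZr mulrA nu mul1r.
by rewrite -h1 -h2; apply: le_trans (ler_norm _) _; exact: rdot_CS.
Qed.

Lemma normc_inner x y : normc (inner x y) <= 2^-1 * (rdot x x + rdot y y).
Proof.
apply: le_trans (normc_inner_CS x y) _; rewrite -!hnorm_sqr.
by have := sqr_ge0 (hnorm x - hnorm y); nra.
Qed.

(** By polarization, the quadratic form of a hermitian r at these vectors determines both the real
    and the imaginary part of <r (xi i k), eta i k> for i, k < n. *)
Definition test_vectors (xi eta : nat -> nat -> H) n : seq H :=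
  flatten [seq [:: xi i k + eta i k; xi i k - eta i k;
    xi i k + 'i%C *: eta i k; xi i k - 'i%C *: eta i k] | i <- iota 0 n, k <- iota 0 n].

Lemma mem_test_vectors xi eta i k n : (i < n)%N -> (k < n)%N ->
  {subset [:: xi i k + eta i k; xi i k - eta i k;
    xi i k + 'i%C *: eta i k; xi i k - 'i%C *: eta i k] <= test_vectors xi eta n}.
Proof.
move=> iN kN x xin; apply/flattenP; exists [:: xi i k + eta i k; xi i k - eta i k;
    xi i k + 'i%C *: eta i k; xi i k - 'i%C *: eta i k] => //.
by apply/allpairsP; exists (i, k); rewrite !mem_iota.
Qed.

Lemma sum_cauchy (w : nat -> R) C : (forall k, 0 <= w k) ->
  (forall n, \sum_(0 <= k < n) w k <= C) ->
  forall eps, 0 < eps -> exists N, forall n, (N <= n)%N -> \sum_(N <= k < n) w k < eps.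
Proof.
move=> w0 wC eps eps0.
have nd : nondecreasing_seq (fun n => \sum_(0 <= k < n) w k).
  move=> m n mn; rewrite [X in _ <= X](big_cat_nat (n := m)) //= lerDl.
  exact: sumr_ge0.
have /cvg_ex[/= l /cvgrPdist_lt gl] : cvgn (fun n => \sum_(0 <= k < n) w k).
  by apply: nondecreasing_is_cvgn => //; exists C => _ [n _ <-].
have e2 : 0 < eps / 2 by rewrite divr_gt0.
have [N _ Ng] := gl _ e2; exists N => n Nn.
have /ltr_distlDr := Ng _ (leqnn N); have /ltr_distlCDr := Ng _ Nn.
rewrite (big_cat_nat (n := N)) //=; lra.
Qed.

(** For contractions the terms of the series have the common summable bound [w k], so the tails are
    uniformly small; the finitely many other terms tend to 0 by hypothesis. *)
Lemma normal_functional_small M (f : (H -> H) -> R[i]) (xi eta : nat -> H)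
    (r : nat -> H -> H) :
  square_summable xi -> square_summable eta ->
  (forall T, M T -> series (fun k => inner (T (xi k)) (eta k) : R[i]^o) @ \oo
     --> (f T : R[i]^o)) ->
  (forall n, M (r n)) -> (forall n x, hnorm (r n x) <= hnorm x) ->
  (forall k, normc (inner (r n (xi k)) (eta k)) @[n --> \oo] --> (0 : R)) ->
  forall eps, 0 < eps -> \forall n \near \oo, normc (f (r n)) < eps.
Proof.
move=> [C1 xiC] [C2 etaC] fM Mr cr r0 eps eps0.
have e3 : 0 < eps / 3 by rewrite divr_gt0.
pose w k := 2^-1 * (rdot (xi k) (xi k) + rdot (eta k) (eta k)).
have w0 k : 0 <= w k by rewrite mulr_ge0 // addr_ge0 // rdot_ge0.
have sumC (z : nat -> H) C : (forall n, \sum_(k < n) `|z k| ^+ 2 <= C%:C) ->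
    forall n, \sum_(0 <= k < n) rdot (z k) (z k) <= C.
  move=> zC n; rewrite -lecR; apply: le_trans (zC n).
  rewrite big_mkord rmorph_sum le_eqVlt; apply/orP; left; apply/eqP.
  by apply: eq_bigr => k _; rewrite -inner_norm; exact: rdotxx.
have wC n : \sum_(0 <= k < n) w k <= 2^-1 * (C1 + C2).
  by rewrite -big_distrr big_split /= ler_wpM2l // lerD ?sumC.
have [N wN] := sum_cauchy w0 wC e3.
have sumN : \sum_(0 <= k < N) normc (inner (r n (xi k)) (eta k)) @[n --> \oo] --> (0 : R).
  elim: (N) => [|m IH].
    by under eq_fun => n do rewrite big_nil; exact: cvg_cst.
  have -> : (fun n => \sum_(0 <= k < m.+1) normc (inner (r n (xi k)) (eta k))) =
      (fun n => \sum_(0 <= k < m) normc (inner (r n (xi k)) (eta k)) +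
         normc (inner (r n (xi m)) (eta m))).
    by apply/funext => n; rewrite big_nat_recr.
  by rewrite -[X in _ --> X](addr0 (0 : R)); exact: cvgD.
have /cvgrPdist_lt/(_ _ e3) near_sum := sumN.
apply: filterS near_sum => n; rewrite sub0r normrN => hn.
have e3C : 0 < (eps / 3)%:C by rewrite ltcR.
(* The rank m from which the partial sums approximate [f (r n)] depends on n; the tail bound beyond
   N does not. *)
have /cvgrPdist_lt/(_ _ e3C)[m _ mP] := fM _ (Mr n).
have {mP} := mP (maxn m N) (leq_maxl _ _).
rewrite /series /= -[ `|_| ]/((normc _)%:C) ltcR.
set s := \sum_(0 <= k < maxn m N) _ => h1.
have normc_sum (a b : nat) (F : nat -> R[i]) :
    normc (\sum_(a <= k < b) F k) <= \sum_(a <= k < b) normc (F k).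
  elim/big_ind2: _ => [|x1 x2 y1 y2 h2 h3|//]; first by rewrite normc0.
  exact: le_trans (le_normcD _ _) (lerD h2 h3).
have h2 : normc s < eps / 3 + eps / 3.
  rewrite /s (big_cat_nat (n := N)) ?leq_maxr //=.
  apply: le_lt_trans (le_normcD _ _) _; apply: ltrD.
    apply: le_lt_trans (normc_sum _ _ _) _; apply: le_lt_trans hn.
    exact: ler_norm.
  apply: le_lt_trans (normc_sum _ _ _) _; apply: le_lt_trans (wN _ (leq_maxr _ _)).
  apply: ler_sum => k _; apply: le_trans (normc_inner _ _) _.
  rewrite /w ler_wpM2l // lerD2r -!hnorm_sqr ler_sqr ?nnegrE ?hnorm_ge0 //.
have -> : f (r n) = (f (r n) - s) + s by rewrite subrK.
apply: le_lt_trans (le_normcD _ _) _; lra.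
Qed.

Lemma vector_functional_normal M x y : normal_functional M (fun T => inner (T x) y).
Proof.
have ss (z : H) : square_summable (fun k => if k == 0%N then z else 0).
  exists (rdot z z) => n; have [->|n0] := posnP n.
    by rewrite big_ord0 ler0c rdot_ge0.
  rewrite -(prednK n0) big_ord_recl /= big1 ?addr0; last by move=> i _; rewrite normr0 expr0n.
  by rewrite rdotxx inner_norm.
exists (fun k => if k == 0%N then x else 0), (fun k => if k == 0%N then y else 0).
split=> // T MT; apply: cvg_near_cst; near=> n.
have n0 : (0 < n)%N by near: n; exact: nbhs_infty_gt.
rewrite /series /= -(prednK n0) big_nat_recl //= big1 ?addr0 // => i _.
exact: linear0r.
Unshelve. all: by end_near. Qed.

(** A dense sequence in the predual is given by countably many vectors. Halving e on more and more
    of them, with error 1/(n+1), makes r n = 2 q n - e tend to 0 against every [f i]; as the [r n]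
    are contractions, density extends this to all vector functionals. *)
Lemma weak_halving_sequence M e (P : set (H -> H)) :
  von_neumann M -> separable_predual M -> M e -> projection e -> P `<=` M ->
  (forall q, P q -> projection q) ->
  (forall xs eps, 0 < eps -> exists q, [/\ P q, forall x, e (q x) = q x &
     \sum_(x <- xs) (rdot (q x) x *+ 2 - rdot (e x) x) ^+ 2 <=
     eps * \sum_(x <- xs) rdot (e x) x]) ->
  exists q : nat -> H -> H, (forall n, P (q n) /\ forall x, e (q n x) = q n x) /\
    forall x y, rdot (q n x) y @[n --> \oo] --> 2^-1 * rdot (e x) y.
Proof.
move=> vM [f [fN fD]] Me pe PM Pproj halve.
have /choice[xi /choice[eta fP]] : forall n, exists xi, exists eta,
    [/\ square_summable xi, square_summable eta & forall T, M T ->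
      series (fun k => inner (T (xi k)) (eta k) : R[i]^o) @ \oo --> (f n T : R[i]^o)].
  by move=> n; have [xi [eta h]] := fN n; exists xi, eta.
have se (xs : seq H) : 0 <= \sum_(x <- xs) rdot (e x) x.
  by apply: sumr_ge0 => x _; rewrite projectionxx // rdot_ge0.
have /choice[q qP] n : exists q, [/\ P q, forall x, e (q x) = q x &
    \sum_(x <- test_vectors xi eta n) (rdot (q x) x *+ 2 - rdot (e x) x) ^+ 2 <=
    n.+1%:R^-1].
  (* Dividing by 1 plus the mass of e brings the final error below 1/(n+1); the summand 1 keeps the
     denominator positive. *)
  have e0 : 0 < n.+1%:R^-1 / (1 + \sum_(x <- test_vectors xi eta n) rdot (e x) x).
    by rewrite divr_gt0 ?invr_gt0 // ltr_pwDl.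
  have [q [Pq eq hq]] := halve (test_vectors xi eta n) _ e0; exists q; split=> //.
  apply: le_trans hq _; rewrite -mulrA ler_piMr ?invr_ge0 //.
  by rewrite mulrC ler_pdivrMr ?ltr_pwDl // mul1r lerDr.
have eq n x : e (q n x) = q n x by case: (qP n).
have pq n : projection (q n) by case: (qP n) => /Pproj.
have Mq n : M (q n) by case: (qP n) => /PM.
pose r n x := q n x *+ 2 - e x.
have rE n : r n = ((-1) \*: e) \+ ((2 : R[i]) \*: q n).
  by apply/funext => x; rewrite /r /= scaleN1r addrC scaler_nat.
have Mr n : M (r n) by rewrite rE; apply: vN_lin => //; exact: vN_Z.
have lr n : linear (r n) by case: (vN_bounded vM (Mr n)).
have hr n x y : rdot (r n x) y = rdot x (r n y).
  case: (pq n) pe => _ hq _ [_ he _].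
  by rewrite /r mulr2n !rdotBl !rdotBr !rdotDl !rdotDr he hq.
have cr n x : hnorm (r n x) <= hnorm x by exact: reflection_contraction.
have rdiag m x : (forall n, (m <= n)%N -> x \in test_vectors xi eta n) ->
    rdot (r n x) x @[n --> \oo] --> (0 : R).
  move=> xin; apply/cvgrPdist_lt => eps eps0.
  have e2 : 0 < eps ^+ 2 by rewrite exprn_gt0.
  near=> n; rewrite sub0r normrN -ltr_sqr ?nnegrE ?(ltW eps0) // real_normK ?num_real //.
  have [_ _ hq] := qP n.
  have -> : rdot (r n x) x = rdot (q n x) x *+ 2 - rdot (e x) x.
    by rewrite /r mulr2n rdotBl rdotDl -mulr2n.
  apply: (@le_lt_trans _ _ (n.+1%:R^-1)); last first.
    by near: n; exact: near_infty_natSinv_lt (PosNum e2).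
  apply: le_trans hq; have xn : x \in test_vectors xi eta n.
    by apply: xin; near: n; exact: nbhs_infty_ge.
  by rewrite (big_rem x) //= lerDl; apply: sumr_ge0 => z _; rewrite sqr_ge0.
have roff i k : normc (inner (r n (xi i k)) (eta i k)) @[n --> \oo] --> (0 : R).
  have diag x : x \in [:: xi i k + eta i k; xi i k - eta i k;
      xi i k + 'i%C *: eta i k; xi i k - 'i%C *: eta i k] ->
      rdot (r n x) x @[n --> \oo] --> (0 : R).
    move=> xin; apply: (rdiag (maxn i k).+1) => n nm.
    by apply: mem_test_vectors xin; apply: leq_trans nm; rewrite ltnS ?leq_maxl ?leq_maxr.
  have pol y : rdot (r n (xi i k + y)) (xi i k + y) @[n --> \oo] --> (0 : R) ->
      rdot (r n (xi i k - y)) (xi i k - y) @[n --> \oo] --> (0 : R) ->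
      `|rdot (r n (xi i k)) y| @[n --> \oo] --> (0 : R).
    move=> h1 h2; rewrite -[X in _ --> X](normr0 R); apply: cvg_norm.
    have -> : (fun n => rdot (r n (xi i k)) y) =
        (fun n => 4^-1 * (rdot (r n (xi i k + y)) (xi i k + y) -
                          rdot (r n (xi i k - y)) (xi i k - y))).
      by apply/funext => n; exact: rdot_polarization.
    rewrite -[X in _ --> X](mulr0 (4^-1)); apply: cvgMl_tmp.
    by rewrite -[X in _ --> X](subr0 (0 : R)); exact: cvgB.
  have h : `|rdot (r n (xi i k)) (eta i k)| + `|rdot (r n (xi i k)) ('i%C *: eta i k)|
      @[n --> \oo] --> (0 : R).
    rewrite -[X in _ --> X](addr0 (0 : R)).
    by apply: cvgD; apply: pol; apply: diag; rewrite !inE eqxx ?orbT.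
  apply: squeeze_cvgr (cvg_cst 0) h; apply: nearW => n.
  by rewrite normc_le_rdot normc_nneg.
exists q; split=> [n|x y]; first by split=> //; case: (qP n).
have rw : rdot (r n x) y @[n --> \oo] --> (0 : R).
  apply/cvgrPdist_lt => eps eps0; have e2 : 0 < eps / 2 by rewrite divr_gt0.
  have [i hi] := fD _ (vector_functional_normal M x y) _ e2.
  have [s1 s2 s3] := fP i.
  have := normal_functional_small s1 s2 s3 Mr cr (roff i) e2.
  apply: filterS => n hn; rewrite sub0r normrN.
  have {}hi := hi _ (Mr n).
  have : (normc (inner (r n x) y - f i (r n)) <= eps / 2).
    by rewrite -lecR; apply: hi => z; rewrite !normE lecR.
  have h0 : `|rdot (r n x) y| <= normc (inner (r n x) y).
    by rewrite -lecR; exact: normc_ge_Re.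
  have h3 := le_normcD (inner (r n x) y - f i (r n)) (f i (r n)).
  rewrite subrK in h3; lra.
have qE n : rdot (q n x) y = 2^-1 * rdot (r n x) y + 2^-1 * rdot (e x) y.
  by rewrite /r mulr2n rdotBl rdotDl; field.
have -> : (fun n => rdot (q n x) y) =
    (fun n => 2^-1 * rdot (r n x) y + 2^-1 * rdot (e x) y) by apply/funext.
rewrite -[X in _ --> X]add0r; apply: cvgD; last exact: cvg_cst.
by rewrite -[X in _ --> X](mulr0 (2^-1 : R)); exact: cvgMl_tmp.
Unshelve. all: by end_near. Qed.

End HalvingSequence.

(** * The algebra spanned by 1 and a projection *)

Section ProjectionAlgebra.
Context {R : realType} {H : hilbertType R}.
Implicit Types (x y z : H) (p : H -> H).

Definition projection_algebra p : set (H -> H) :=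
  [set T | exists a b : R[i], T = (a \*: idfun) \+ (b \*: p)].

Lemma projection_bounded p : projection p -> bounded_op p.
Proof.
move=> pp; apply: contraction_bounded_op => [|x]; first by case: pp.
by rewrite -ler_sqr ?nnegrE ?hnorm_ge0 // !hnorm_sqr projection_le.
Qed.

Lemma projection_algebra_bounded p T : projection p -> projection_algebra p T -> bounded_op T.
Proof.
move=> /projection_bounded bp [a [b ->]]; apply: bounded_op_lin bounded_op_id _.
have := bounded_op_lin (b - 1) bp bp; congr bounded_op.
by apply/funext => x /=; rewrite scalerBl scale1r subrK.
Qed.

(* The bicommutant is detected by the rank one operators x |-> <x, y> z with y and z
   in the same eigenspace of p. *)
Lemma projection_bicommutant_scalar p T (k : R) : projection p ->
  commutant (commutant (projection_algebra p)) T ->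
  exists a : R[i], forall z, p z = k%:C *: z -> T z = a *: z.
Proof.
move=> pp /commutantP[bT TC].
have [[y py y0]|ny] := pselect (exists2 y, p y = k%:C *: y & y <> 0); last first.
  exists 0 => z pz; rewrite scale0r.
  have [->|z0] := eqVneq z 0; first exact: lin0 bT.1.
  by case: ny; exists z => //; exact/eqP.
(* With S the rank one operator below, T S y = S T y reads <y, y> T z = <T y, y> z. *)
exists (inner (T y) y / inner y y) => z pz.
pose S x := inner x y *: z.
have CS : commutant (projection_algebra p) S.
  apply/commutantP; split.
    apply: (@linear_bounded_op _ _ _ (hnorm y * hnorm z)).
      by move=> c x w; rewrite /S innerDl innerZl scalerDl scalerA.
    move=> x; rewrite -lecR hnormZ -[ `|_| ]/((normc _)%:C) -rmorphM lecR /=.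
    rewrite mulrAC ler_wpM2r ?hnorm_ge0 // mulrC; exact: normc_inner_CS.
  move=> _ [a [b ->]] x; rewrite /S /= innerDl !innerZl.
  have [lp hp _] := pp.
  have -> : inner (p x) y = k%:C * inner x y.
    have /adjoint_rdot -> // : forall x y, rdot (p x) y = rdot x (p y) := hp.
    by rewrite py innerZr conjc_real.
  rewrite (linZ _ lp) pz scalerDl !scalerA; congr (_ *: _ + _ *: _); ring.
have := TC _ CS y; rewrite /S (linZ _ bT.1) => e.
have iy0 : inner y y != 0.
  by rewrite inner_norm expf_eq0 normr_eq0 /=; exact/eqP.
apply: (scalerI iy0); rewrite e scalerA mulrC divfK //.
Qed.

(** An element of the bicommutant is a scalar a on the range of p and a scalar b on its kernel,
    hence equals b + (a - b) p. *)
Lemma projection_algebra_vN p : projection p -> von_neumann (projection_algebra p).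
Proof.
move=> pp; have [lp hp pK] := pp; split.
  move=> T [a [b ->]]; exists ((a^*%C \*: idfun) \+ (b^*%C \*: p)).
    by exists a^*%C, b^*%C.
  have ap : adjoint p p by exact: adjoint_rdot.
  by move=> x y /=; rewrite innerDl innerDr !innerZl !innerZr ap !conjcK.
apply/seteqP; split; last first.
  by apply: sub_bicommutant => T; exact: projection_algebra_bounded.
move=> T CT; have bT := commutant_bounded CT.
have [a aP] := projection_bicommutant_scalar 1 pp CT.
have [b bP] := projection_bicommutant_scalar 0 pp CT.
exists b, (a - b); apply/funext => x /=.
have -> : T x = T (p x) + T (x - p x) by rewrite -(linD bT.1) addrC subrK.
rewrite aP ?bP ?(linB lp) ?pK ?subrr ?scale0r ?scale1r //.
by rewrite scalerBr scalerBl addrCA addrC.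
Qed.

End ProjectionAlgebra.

(** * Absence of cluster points in the Effros-Maréchal topology *)

Section Topology.
Context {R : realType} {H : hilbertType R}.
Variable M : set (H -> H).
Implicit Types (K : nat -> SubAlg M) (A B : SubAlg M).

Lemma SubAlg_eq A B : subalg_set A = subalg_set B -> A = B.
Proof.
case: A B => [A vA sA] [B vB sB] /= AB; subst B.
by congr Build_SubAlg; exact: Prop_irrelevance.
Qed.

Lemma increasing_ge (s : nat -> nat) : {homo s : m n / (m < n)%N} ->
  forall n, (n <= s n)%N.
Proof. by move=> hs; elim=> // n IH; exact: leq_ltn_trans IH (hs _ _ (ltnSn n)). Qed.

Lemma cvg_increasing (s : nat -> nat) (T : topologicalType) (u : nat -> T) (l : T) :
  {homo s : m n / (m < n)%N} -> u n @[n --> \oo] --> l -> u (s n) @[n --> \oo] --> l.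
Proof.
move=> hs; apply: cvg_comp => B [N _ NB]; exists N => // n /= Nn.
by apply: NB => /=; exact: leq_trans Nn (increasing_ge hs n).
Qed.

Lemma increasing_subseq (P : nat -> Prop) :
  (forall N, exists2 n, (N <= n)%N & P n) ->
  exists2 s : nat -> nat, {homo s : m n / (m < n)%N} & forall n, P (s n).
Proof.
move=> inf; have [n0 _ Pn0] := inf 0.
have [||s sP] := @dependent_choice_nat _ (fun _ => P) (fun m n => (m < n)%N) n0 => //.
  by move=> _ n _; have [m nm Pm] := inf n.+1; exists m.
exists s => [|n]; last by have [] := sP n.
by apply: homo_ltn => [|n]; [exact: ltn_trans|have [] := sP n].
Qed.

Lemma EM_limsup_mem K A (s : nat -> nat) (v : nat -> H -> H) T : M T -> EM_cvg K A ->
  {homo s : m n / (m < n)%N} -> (forall n, (K (s n) : set _) (v n)) ->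
  (forall n x, hnorm (v n x) <= hnorm x) ->
  (forall x y, rdot (v n x) y @[n --> \oo] --> rdot (T x) y) -> (A : set _) T.
Proof.
move=> MT [_ <-] hs Kv cv vT.
have sI : injective s.
  move=> i j ij; case: (ltngtP i j) => // /hs; by rewrite ij ltnn.
(* [limsup_vN] asks for a sequence through all the algebras: v is placed at the distinct indices
   [s m], and the identity everywhere else. *)
have /choice[u uP] n : exists u, [/\ (K n : set _) u, forall x, hnorm (u x) <= hnorm x &
    forall m, s m = n -> u = v m].
  have [[m <-]|nm] := pselect (exists m, s m = n).
    by exists (v m); split=> // m' /sI ->.
  exists idfun; split=> // [|m smn]; first exact: vN_id (subalg_vN (K n)).
  by case: nm; exists m.
apply: sub_generated_vN; split=> //; exists u, s; split=> //.
- by move=> n; case: (uP n).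
- by exists 1 => n x; rewrite mul1r !normE lecR; case: (uP n).
move=> x y; apply: cvg_inner => z; have -> : u \o s = v.
  by apply/funext => n /=; case: (uP (s n)) => _ _ /(_ n erefl).
exact: vT.
Qed.

Lemma projection_algebra_sub (B : set (H -> H)) (q : H -> H) : von_neumann B -> B q ->
  projection_algebra q `<=` B.
Proof.
move=> vB Bq _ [a [b ->]]; apply: vN_lin => //; first exact: vN_id.
exact: vN_Z.
Qed.

Lemma projection_algebra_mem (q : H -> H) : projection_algebra q q.
Proof. by exists 0, 1; apply/funext => x /=; rewrite scale0r add0r scale1r. Qed.

Lemma hnorm_projection (q : H -> H) x : projection q -> hnorm (q x) <= hnorm x.
Proof.
by move=> pq; rewrite -ler_sqr ?nnegrE ?hnorm_ge0 // !hnorm_sqr projection_le.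
Qed.

Hypothesis vM : von_neumann M.

(** Elements of the liminf are strong limits along the subsequence, hence lie in B, which is
    strongly closed. Conversely the constant sequence q puts q into the limsup. *)
Lemma EM_cvg_const_subseq K A B q (s : nat -> nat) : EM_cvg K A ->
  projection q -> subalg_set B = projection_algebra q ->
  {homo s : m n / (m < n)%N} -> (forall n, K (s n) = B) -> A = B.
Proof.
move=> KA pq Bq hs KB; apply: SubAlg_eq; apply/seteqP; split => [T|].
  case: (KA) => <- _ [MT [u [Ku _ [v [S [_ _ uT _]]]]]].
  apply: (@vN_cvg _ _ _ (u \o s) _ (subalg_vN B)) => [|n|x].
  - exact: vN_bounded MT.
  - by rewrite -(KB n); exact: Ku.
  - exact: (@cvg_increasing s _ (u ^~ x)).
have Bqq : (B : set _) q by rewrite Bq; exact: projection_algebra_mem.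
rewrite Bq; apply: projection_algebra_sub (subalg_vN A) _.
apply: (EM_limsup_mem (v := fun=> q) _ KA hs) => //.
- exact: subalg_sub Bqq.
- by move=> n; rewrite KB.
- by move=> _ x; exact: hnorm_projection.
by move=> x y; exact: cvg_cst.
Qed.

Variables (p : H -> H) (q : nat -> H -> H) (xi eta : H).
Hypotheses (Mp : M p) (Mq : forall n, M (q n)).
Hypotheses (pp : projection p) (pq : forall n, projection (q n)).
Hypothesis qp : forall n x, p (q n x) = q n x.
Hypothesis q_weak : forall x y, rdot (q n x) y @[n --> \oo] --> 2^-1 * rdot (p x) y.
Hypotheses (pxi : p xi = 0) (peta : p eta = eta) (xi0 : xi <> 0) (eta0 : eta <> 0).

Let qxi n : q n xi = 0.
Proof.
apply: rdot_ext => z; case: (pq n) => _ hq _; have [_ hp _] := pp.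
by rewrite hq -qp -hp pxi !rdot0l.
Qed.

Let eta_gt0 : 0 < rdot eta eta.
Proof. by rewrite lt_neqAle rdot_ge0 andbT eq_sym; apply/eqP => /rdot_eq0. Qed.

Let qeta : rdot (q n eta) (q n eta) @[n --> \oo] --> 2^-1 * rdot eta eta.
Proof.
have := @q_weak eta eta; rewrite peta.
have -> // : (fun n => rdot (q n eta) eta) = (fun n => rdot (q n eta) (q n eta)).
by apply/funext => n; exact: projectionxx.
Qed.

Definition projection_subalg n : SubAlg M :=
  Build_SubAlg (projection_algebra_vN (pq n)) (projection_algebra_sub vM (Mq n)).

Lemma projection_subalg_not_subseq_cvg K A (s g : nat -> nat) :
  {homo s : m n / (m < n)%N} -> {homo g : m n / (m < n)%N} ->
  (forall n, K (s n) = projection_subalg (g n)) -> ~ EM_cvg K A.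
Proof.
move=> hs hg KN KA; pose T : H -> H := ((2^-1 : R)%:C \*: p).
have MT : M T by exact: vN_Z.
have AT : (A : set _) T.
  apply: (EM_limsup_mem (v := fun n => q (g n)) _ KA hs) => //.
  - by move=> n; rewrite KN; exact: projection_algebra_mem.
  - by move=> n x; exact: hnorm_projection.
  move=> x y; rewrite rdotZl.
  exact: (@cvg_increasing g _ (fun n => rdot (q n x) y)).
move: AT; case: KA => <- _ [_ [w [Kw _ [w' [S [_ _ wT _]]]]]].
have /choice[a /choice[b wE]] : forall n, exists a b : R[i],
    w (s n) = (a \*: idfun) \+ (b \*: q (g n)).
  by move=> n; have := Kw (s n); rewrite KN.
(* Every q n vanishes at xi, so w xi = a xi, which tends to T xi = 0. *)
have axi : a n *: xi @[n --> \oo] --> (0 : H).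
  have := @cvg_increasing s _ (w ^~ xi) _ hs (wT xi).
  rewrite /T /= pxi scaler0.
  have -> // : (fun n => w (s n) xi) = (fun n => a n *: xi).
  by apply/funext => n; rewrite wE /= qxi scaler0 addr0.
have aeta : a n *: eta @[n --> \oo] --> (0 : H).
  move/cvg_hnorm : axi => axi; apply/cvg_hnorm.
  have xi_neq0 : hnorm xi != 0 by apply/eqP => /hnorm0_eq0.
  have h : hnorm (a n *: xi - 0) * (hnorm eta / hnorm xi) @[n --> \oo] --> (0 : R).
    by rewrite -[X in _ --> X](mul0r (hnorm eta / hnorm xi)); exact: cvgMr_tmp.
  have -> // : (fun n => hnorm (a n *: eta - 0)) =
    (fun n => hnorm (a n *: xi - 0) * (hnorm eta / hnorm xi)).
  apply/funext => n; rewrite !subr0; apply: complexI; rewrite rmorphM /= !hnormZ.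
  rewrite -mulrA -(rmorphM _ (hnorm xi)) mulrCA mulfV // mulr1 //.
have beta : b n *: q (g n) eta @[n --> \oo] --> T eta.
  rewrite -[X in _ --> X](subr0 (T eta)).
  have -> : (fun n => b n *: q (g n) eta) = (fun n => w (s n) eta - a n *: eta).
    by apply/funext => n; rewrite wE /= addrAC subrr add0r.
  by apply: cvgB => //; exact: (@cvg_increasing s _ (w ^~ eta)).
(* For y = b q eta, Cauchy-Schwarz gives <y, eta>^2 = <y, q eta>^2 <= |y|^2 |q eta|^2. The limits of
   the two sides, in [l1] and [l2], are |eta|^4/4 and |eta|^4/8. *)
have l1 : rdot (b n *: q (g n) eta) eta * rdot (b n *: q (g n) eta) eta @[n --> \oo]
    --> (2^-1 * rdot eta eta) * (2^-1 * rdot eta eta).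
  have -> : 2^-1 * rdot eta eta = rdot (T eta) eta by rewrite /T /= peta rdotZl.
  have h : rdot (b n *: q (g n) eta) eta @[n --> \oo] --> rdot (T eta) eta.
    exact: cvg_rdot beta (cvg_cst eta).
  exact: cvgM.
have l2 : rdot (b n *: q (g n) eta) (b n *: q (g n) eta) *
    rdot (q (g n) eta) (q (g n) eta) @[n --> \oo] -->
    2^-1 * (2^-1 * rdot eta eta) * (2^-1 * rdot eta eta).
  apply: cvgM; last exact: (@cvg_increasing g _ (fun n => rdot (q n eta) (q n eta))).
  by have := cvg_rdot beta beta; rewrite /T /= peta rdotZl rdotZr.
have : (2^-1 * rdot eta eta) * (2^-1 * rdot eta eta) <=
    2^-1 * (2^-1 * rdot eta eta) * (2^-1 * rdot eta eta).
  apply: ler_cvg_to l1 l2 _; apply: nearW => n.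
  set y := b n *: q (g n) eta.
  have -> : rdot y eta = rdot y (q (g n) eta).
    have [lq hq qq] := pq (g n).
    by rewrite -hq /y (linZ _ lq) qq.
  rewrite -expr2 -!hnorm_sqr -exprMn -(real_normK (num_real (rdot y _))).
  by rewrite ler_sqr ?nnegrE ?mulr_ge0 ?hnorm_ge0 // rdot_CS.
by have := eta_gt0; nra.
Qed.

(** If span(1, q_j) = span(1, q_n), evaluation at xi shows that q_j is a multiple of q_n, so <q_j
    eta, q_n eta> = <q_j eta, eta>. For infinitely many such j the weak limits give |q_n eta|^2 =
    |eta|^2 along a subsequence of n, against the limit |eta|^2/2. *)
Lemma projection_subalg_not_repeated A :
  exists N, forall n, (N <= n)%N -> projection_subalg n <> A.
Proof.
apply: contrapT => /forallNP inf.
have [|s hs sA] := @increasing_subseq (fun n => projection_subalg n = A).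
  move=> N; have := inf N => /existsNP[n /not_implyP[Nn /contrapT nA]].
  by exists n.
have tn n : rdot (q (s n) eta) (q (s n) eta) = rdot eta eta.
  set z := q (s n) eta.
  have e1 : rdot (q (s j) eta) z @[j --> \oo] --> 2^-1 * rdot z z.
    have := @cvg_increasing s _ (fun j => rdot (q j eta) z) _ hs (@q_weak eta z).
    by rewrite peta (_ : rdot eta z = rdot z z) // rdotC /z projectionxx.
  have e2 : rdot (q (s j) eta) z @[j --> \oo] --> 2^-1 * rdot eta eta.
    have := @cvg_increasing s _ (fun j => rdot (q j eta) (q j eta)) _ hs qeta.
    have -> // : (fun j => rdot (q (s j) eta) (q (s j) eta)) = (fun j => rdot (q (s j) eta) z).
    apply/funext => j.
    have [a [b qab]] : projection_algebra (q (s n)) (q (s j)).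
      have := projection_algebra_mem (q (s j)).
      rewrite -[projection_algebra (q (s j))]/(subalg_set (projection_subalg (s j))).
      by rewrite sA -(sA n).
    have a0 : a = 0.
      have /(congr1 (@^~ xi)) := qab; rewrite /= !qxi scaler0 addr0 => /esym/eqP.
      by rewrite scaler_eq0 => /orP[/eqP|/eqP].
    have [lq hq qq] := pq (s n).
    rewrite -(projectionxx _ (pq _)) /z -hq qab /= a0 scale0r add0r.
    by rewrite (linZ _ lq) qq.
  by have := rcvg_uniq e1 e2; lra.
have := @cvg_increasing s _ (fun n => rdot (q n eta) (q n eta)) _ hs qeta.
have -> : (fun n => rdot (q (s n) eta) (q (s n) eta)) = (fun=> rdot eta eta).
  exact/funext.
move=> h; have e : 2^-1 * rdot eta eta = rdot eta eta by exact: rcvg_uniq h (cvg_cst _).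
by have := eta_gt0; lra.
Qed.

(** Suppose K converges to A and meets the tail infinitely often. Either one algebra of the tail
    recurs, and equals A by [EM_cvg_const_subseq]; or the indices met are unbounded, and K shares a
    subsequence with the span(1, q_n), which [projection_subalg_not_subseq_cvg] excludes. *)
Lemma projection_subalg_tail_closed m :
  EM_open [set A | forall n, (m <= n)%N -> projection_subalg n <> A].
Proof.
move=> K A KA UA.
apply: contrapT => nnear.
have inf J : exists2 j, (J <= j)%N & exists2 n, (m <= n)%N & projection_subalg n = K j.
  apply: contrapT => nex; apply: nnear; exists J => // j /= Jj n mn nK.
  by apply: nex; exists j => //; exists n.
have [[n0 mn0 inf0]|fin] := pselect (exists2 n0, (m <= n0)%N &
    forall J, exists2 j, (J <= j)%N & K j = projection_subalg n0).
  have [s hs sK] := increasing_subseq inf0.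
  apply: (UA n0 mn0).
  by rewrite (EM_cvg_const_subseq (B := projection_subalg n0) KA (pq n0) erefl hs sK).
(* Each of the finitely many indices from m up to b occurs only finitely often in K, so late members
   of K in the tail have index at least b. *)
have unb b J : exists2 j, (J <= j)%N & exists2 n, (b <= n)%N & projection_subalg n = K j.
  have [J' J'P] : exists J', forall j, (J' <= j)%N -> forall n, (m <= n)%N -> (n < b)%N ->
      K j <> projection_subalg n.
    elim: b => [|b [J1 J1P]]; first by exists 0.
    have [bm|bm] := ltnP b m.
      exists 0 => j _ n mn; rewrite ltnS => nB.
      by have := leq_ltn_trans (leq_trans mn nB) bm; rewrite ltnn.
    have [J2 J2P] : exists J2, forall j, (J2 <= j)%N -> K j <> projection_subalg b.
      apply: contrapT => /forallNP h; apply: fin; exists b => // J2.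
      have := h J2 => /existsNP[j /not_implyP[Jj /contrapT Kj]].
      by exists j.
    exists (maxn J1 J2) => j; rewrite geq_max => /andP[j1 j2] n mn.
    by rewrite ltnS leq_eqVlt => /orP[/eqP ->|nB]; [exact: J2P|exact: J1P].
  have [j] := inf (maxn J J'); rewrite geq_max => /andP[jJ jJ'] [n mn nK].
  exists j => //; exists n => //; rewrite leqNgt; apply/negP => nB.
  exact: (J'P _ jJ' _ mn nB).
have [j0 _ [n0 _ nK0]] := unb 0 0.
have [||f fP] := @dependent_choice_nat _
    (fun _ (z : nat * nat) => projection_subalg z.2 = K z.1)
    (fun z1 z2 => (z1.1 < z2.1)%N /\ (z1.2 < z2.2)%N) (j0, n0) => //.
  move=> _ [j n] _; have [j' jj' [n' nn' e]] := unb n.+1 j.+1.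
  by exists (j', n').
apply: (@projection_subalg_not_subseq_cvg K A (fun i => (f i).1) (fun i => (f i).2)) => //.
- by apply: homo_ltn => [|i]; [exact: ltn_trans|have [_ []] := fP i].
- by apply: homo_ltn => [|i]; [exact: ltn_trans|have [_ []] := fP i].
by move=> i; have [-> _] := fP i.
Qed.

(** A cluster point A differs from all algebras of some tail; the complement of that tail is then an
    open neighbourhood of A which the sequence eventually avoids. *)
Lemma SubAlg_not_compact : ~ compact [set: SubAlg M].
Proof.
move=> cM.
have [|A [_ clA]] := cM (projection_subalg n @[n --> \oo]); first exact: filterT.
have [N NA] := projection_subalg_not_repeated A.
have nA : nbhs A [set B | forall n, (N <= n)%N -> projection_subalg n <> B].
  apply: open_nbhs_nbhs; split=> //; rewrite SubAlg_openE.
  exact: projection_subalg_tail_closed.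
have Ft : nbhs (projection_subalg n @[n --> \oo])
    [set projection_subalg n | n in [set n | (N <= n)%N]].
  by exists N => // n /= Nn; exists n.
by have [_ [[n Nn <-] /(_ n Nn)]] := clA _ _ Ft nA.
Qed.

End Topology.

Theorem theorem1p3 (R : realType)
  (H : hilbertType R) (M : set (H -> H)) (tau : (H -> H) -> R[i])
  (l2Z : hilbertType R) (delta : int -> l2Z) :
  von_neumann M ->
  separable_predual M ->
  faithful_normal_tracial_state M tau ->
  orthonormal_basis delta ->
  contains_vN M (group_vN delta) ->
  ~ compact [set: SubAlg M].
Proof.
move=> vM sepM trM bd [N [phi iso]].
have [a [Na ha ca diffuse]] := group_vN_diffuse bd (subalg_vN N) iso.
have la : linear a by case: (vN_bounded (subalg_vN N) Na).
have spN e : spectral_proj a e -> (N : set _) e.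
  by move=> [We _ _]; exact: vN_bicommutant (subalg_vN N) Na _ We.
have spM : spectral_proj a `<=` M by move=> e /spN; exact: subalg_sub.
have sp_proj e : spectral_proj a e -> projection e.
  by move=> [/commutant_bounded[le _] he ee].
(* On the zero space 1 + 1 = 1 as operators, so linearity would give tau(1) = 2 tau(1), against
   tau(1) = 1. *)
have [x0 x00] : exists x : H, x <> 0.
  apply: contrapT => /forallNP H0.
  have := trace_linear trM 1 (vN_id vM) (vN_id vM).
  have -> : (1 \*: idfun) \+ idfun = idfun :> (H -> H).
    by apply/funext => x; rewrite (contrapT (H0 x)) /= scaler0 addr0.
  rewrite (trace1 trM) mulr1 => /eqP; rewrite -subr_eq0 opprD addrA subrr sub0r.
  by rewrite oppr_eq0 oner_eq0.
have r0 : 0 < rdot x0 x0.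
  by rewrite lt_neqAle rdot_ge0 andbT eq_sym; apply/eqP => /rdot_eq0.
have halve xs eps e := @diffuse_almost_halvable R H a la ha ca
  (fun e l sp => diffuse e l (spN e sp)) xs eps e.
(* Halving the identity at x0 with eps = |x0|^2/2 gives (2 <p x0, x0> - |x0|^2)^2 <= |x0|^4/2, which
   excludes p x0 = 0 and p x0 = x0. So x0 - p x0 and p x0 can serve as the vectors xi and eta. *)
have [|p [sp _]] := halve [:: x0] (rdot x0 x0 / 2) idfun _ (spectral_proj_id a).
  by rewrite divr_gt0.
rewrite !big_seq1 /= => hp.
have pp := sp_proj p sp; have [lp _ pK] := pp.
have [|q [qP qw]] :=
    @weak_halving_sequence R H M p (spectral_proj a) vM sepM (spM p sp) pp spM sp_proj.
  move=> xs eps eps0; exact: halve.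
apply: (@SubAlg_not_compact R H M vM p q (x0 - p x0) (p x0)) => //.
- exact: spM.
- by move=> n; apply: spM; case: (qP n).
- by move=> n; apply: sp_proj; case: (qP n).
- by move=> n; case: (qP n).
- by rewrite (linB lp) pK subrr.
- move=> /eqP; rewrite subr_eq0 => /eqP px; move: hp; rewrite -px; nra.
by move=> px; move: hp; rewrite px rdot0l; nra.
Qed.
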